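(* Let $S\subset\mathbb{H}^n$ be a closed $C^{1,1}$ hypersurface. Then, for any compact set $K\subset S\setminus S_0$, $\operatorname{reach}(S,K)>0$.
   Context: $\mathbb{H}^n$ is $\mathbb{R}^{2n+1}$ with coordinates $(x_1,y_1,\ldots,x_n,y_n,t)$, with the left-invariant vector fields $X_i=\partial_{x_i}+y_i\partial_t$, $Y_i=\partial_{y_i}-x_i\partial_t$ ($1\le i\le n$), $T=\partial_t$, and $n\ge 1$. The horizontal distribution $\mathcal{H}$ is spanned by the $X_i,Y_i$; $\langle\cdot,\cdot\rangle$ is the Riemannian metric making $\{X_i,Y_i,T\}$ orthonormal. $d$ is the Carnot-Carathéodory distance (infimum of Riemannian lengths of piecewise smooth curves tangent to $\mathcal{H}$ joining two points), and $B(q,r)$ its open balls. $\operatorname{Unp}(S)$ is the set of points $p\in\mathbb{H}^n$ for which there is a unique point of $S$ nearest to $p$ (with respect to $d$). For $q\in S$, $\operatorname{reach}(S,q)$ is the supremum of the $r>0$ with $B(q,r)\subset\operatorname{Unp}(S)$ ($0$ if there is none), and $\operatorname{reach}(S,K)=\inf_{q\in K}\operatorname{reach}(S,q)$. The singular set $S_0$ is the set of $q\in S$ with $T_qS=\mathcal{H}_q$. Class $C^{1,1}$ is meant in the Euclidean sense. *)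

(* Defs.v *)
From HB Require Import structures.
From mathcomp Require Import all_boot all_order all_algebra.
From mathcomp Require Import all_classical all_reals all_analysis.

Set Implicit Arguments.
Unset Strict Implicit.
Unset Printing Implicit Defensive.

Import Order.TTheory GRing.Theory Num.Theory.
Import numFieldNormedType.Exports.

Local Open Scope classical_set_scope.
Local Open Scope ring_scope.

(* A point of H^n is ((x, y), t): the coordinates (x_1, y_1, .., x_n, y_n, t)
   regrouped, with the product topology and the product norm.
   That norm is the sup norm, equivalent to the Euclidean one. Tangent vectors
   are elements of the same space. *)
Notation heis R n := ('rV[R]_n * 'rV[R]_n * R)%type.

Section Frame.
Context {R : realType} {n : nat}.
Implicit Types (p u v : heis R n) (i : 'I_n).

Definition cx p i : R := p.1.1 ord0 i.
Definition cy p i : R := p.1.2 ord0 i.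
Definition ct p : R := p.2.

Definition vfX i p : heis R n := (delta_mx ord0 i, 0, cy p i).
Definition vfY i p : heis R n := (0, delta_mx ord0 i, - cx p i).
Definition vfT p : heis R n := (0, 0, 1).

Definition horizontal p : set (heis R n) :=
  [set v | exists a b : 'I_n -> R,
     v = \sum_(i < n) (a i *: vfX i p + b i *: vfY i p)].

(* The T-component of v in the frame (X_i, Y_i, T) at p; the X_i- and
   Y_i-components are cx v i and cy v i (see frame_decomp). *)
Definition theta p v : R :=
  ct v - \sum_(i < n) (cx v i * cy p i - cy v i * cx p i).

(* The metric making the frame orthonormal (see riem_frame). *)
Definition riem p u v : R :=
  \sum_(i < n) (cx u i * cx v i + cy u i * cy v i) + theta p u * theta p v.

Definition riem_norm p v : R := Num.sqrt (riem p v v).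

Definition frame_comb p (a b : 'I_n -> R) (c : R) : heis R n :=
  \sum_(i < n) (a i *: vfX i p + b i *: vfY i p) + c *: vfT p.

Lemma frame_combE p a b c :
  [/\ cx (frame_comb p a b c) =1 a, cy (frame_comb p a b c) =1 b
    & theta p (frame_comb p a b c) = c].
Proof.
have E : frame_comb p a b c =
    (\row_i a i, \row_i b i, \sum_i (a i * cy p i - b i * cx p i) + c).
  rewrite /frame_comb; set s := \sum_(i < n) _.
  have -> : s = (\row_i a i, \row_i b i, \sum_i (a i * cy p i - b i * cx p i)).
    apply/eqP; rewrite -pair_eqE /= -pair_eqE /=; apply/andP; split.
      apply/andP; split; apply/eqP.
        rewrite /s (big_morph (fun v : heis R n => v.1.1)
          (id1 := 0) (op1 := +%R)) //=.
        rewrite [RHS]row_sum_delta; apply: eq_bigr => i _.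
        by rewrite /= mxE scaler0 addr0.
      rewrite /s (big_morph (fun v : heis R n => v.1.2)
        (id1 := 0) (op1 := +%R)) //=.
      rewrite [RHS]row_sum_delta; apply: eq_bigr => i _.
      by rewrite /= mxE scaler0 add0r.
    apply/eqP; rewrite /s (big_morph (fun v : heis R n => v.2)
      (id1 := 0) (op1 := +%R)) //=.
    by apply: eq_bigr => i _; rewrite /= scalerN.
  congr pair; last by rewrite /= [c *: 1]mulr1.
  by congr pair; rewrite /= scaler0 addr0.
rewrite E; split=> [i|i|]; rewrite /cx /cy /theta /ct /= ?mxE //.
under [X in _ - X]eq_bigr => i _ do rewrite /cx /cy /= !mxE.
by rewrite addrC addKr.
Qed.

Lemma frame_decomp p v : v = frame_comb p (cx v) (cy v) (theta p v).
Proof.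
have [hx hy ht] := frame_combE p (cx v) (cy v) (theta p v).
set w := frame_comb _ _ _ _ in hx hy ht *.
have h2 : ct w = ct v.
  move: ht; rewrite /theta.
  under eq_bigr => i _ do rewrite hx hy.
  by move/addIr.
clear ht; clearbody w; move: hx hy h2; rewrite /cx /cy /ct.
case: v w => [[x y] t] [[x' y'] t'] /= hx hy ->.
by congr (_, _, _); apply/rowP => i; rewrite ?hx ?hy.
Qed.

Lemma riem_frame p a b c a' b' c' :
  riem p (frame_comb p a b c) (frame_comb p a' b' c') =
  \sum_(i < n) (a i * a' i + b i * b' i) + c * c'.
Proof.
have [hx hy ht] := frame_combE p a b c.
have [hx' hy' ht'] := frame_combE p a' b' c'.
rewrite /riem ht ht'; congr (_ + _).
by apply: eq_bigr => i _; rewrite hx hy hx' hy'.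
Qed.

End Frame.

Section CarnotCaratheodory.
Context {R : realType} {n : nat}.
Implicit Types (g h : R -> heis R n) (a b : R) (p q : heis R n).

Definition smooth g := forall (k : nat) (s : R), derivable (derive1n k g) s 1.

(* Smoothness on a closed interval means having a smooth extension. *)
Definition smooth_on a b g :=
  exists2 h, smooth h & {in `[a, b], g =1 h}.

Definition piecewise_smooth a b g :=
  exists2 s : seq R, itv_partition a b s &
    forall i, (i < size s)%N -> smooth_on (nth b (a :: s) i) (nth b s i) g.

Definition horizontal_curve a b g :=
  forall s, s \in `]a, b[ -> derivable g s 1 ->
    horizontal (g s) (derive1 g s).

(* For a piecewise smooth curve derive1 is a junk value at finitely many
   parameters only, and these do not affect the integral. *)
Definition riem_length a b g : \bar R :=
  \int[@lebesgue_measure R]_(s in `[a, b])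
    (riem_norm (g s) (derive1 g s))%:E.

Definition cc_dist p q : \bar R :=
  ereal_inf [set l | exists a b g,
    [/\ a < b, piecewise_smooth a b g, horizontal_curve a b g,
        g a = p /\ g b = q & l = riem_length a b g]].

Definition cc_ball q (r : R) : set (heis R n) :=
  [set p | (cc_dist q p < r%:E)%E].

End CarnotCaratheodory.

Section Reach.
Context {R : realType} {n : nat}.
Implicit Types (S K : set (heis R n)) (p q : heis R n).

Definition nearest S p q :=
  S q /\ forall q', S q' -> (cc_dist p q <= cc_dist p q')%E.

Definition Unp S : set (heis R n) := [set p | exists! q, nearest S p q].

(* The element 0 gives the value 0 when no ball is contained in Unp S. *)
Definition reach S q : \bar R :=
  ereal_sup (0%E |` [set r%:E | r in [set r : R | 0 < r /\ cc_ball q r `<=` Unp S]]).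

Definition reach_set S K : \bar R := ereal_inf [set reach S q | q in K].

End Reach.

Section Hypersurface.
Context {R : realType} {n : nat}.
Implicit Types (S U : set (heis R n)) (p q v : heis R n).

Definition C11_on U (f : heis R n -> R) :=
  (forall p, U p -> differentiable f p) /\
  exists L : R, forall p q v, U p -> U q ->
    `|'d f p v - 'd f q v| <= L * `|p - q| * `|v|.

Definition C11_hypersurface S :=
  forall q, S q -> exists (U : set (heis R n)) (f : heis R n -> R),
    [/\ open U, U q, C11_on U f,
        forall p, U p -> exists v, 'd f p v != 0
      & S `&` U = [set p | f p = 0] `&` U].

(* Velocities at q of the C^1 curves lying in S. *)
Definition tangent_space S q : set (heis R n) :=
  [set v | exists g : R -> heis R n,
    [/\ g 0 = q, derive1 g 0 = v &
        \forall s \near (0 : R),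
          [/\ S (g s), derivable g s 1 & {for s, continuous (derive1 g)}]]].

Definition singular_set S : set (heis R n) :=
  [set q | S q /\ tangent_space S q = horizontal q].

End Hypersurface.

(* Main.v *)
Require Import Defs.
From HB Require Import structures.
From mathcomp Require Import all_boot all_order all_algebra.
From mathcomp Require Import all_classical all_reals all_analysis.
From mathcomp Require Import measurable_realfun ring lra.

Set Implicit Arguments.
Unset Strict Implicit.
Unset Printing Implicit Defensive.

Import Order.TTheory GRing.Theory Num.Theory.
Import numFieldNormedType.Exports.

Local Open Scope classical_set_scope.
Local Open Scope ring_scope.

(** The idea: the squared length of horizontal curves is strictly convex, whereas
    a C11 hypersurface is flat up to a quadratic error, and the convexity is the
    stronger the shorter the curves are.

    Let two points q1, q2 of S be nearest to p, at a distance close to rho. A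
    horizontal curve from p is determined by its velocity in the frame (X_i, Y_i),
    so that two curves of constant speed rho, from p to q1 and q2, can be averaged.
    By the parallelogram law the average has length at most rho - A ^ 2 / (8 rho),
    where A is the L^1 distance between the velocities (plen_avg). Its end is the
    midpoint of q1 and q2 up to a vertical error A ^ 2 (avg_endpoint1,
    avg_endpoint2), and the distance between q1 and q2 is of the order of A
    (gap_endpoint1, gap_endpoint2). If S is locally the zero set of f, then f is of
    the order of A ^ 2 at the midpoint (chart_midpoint), hence also at the end of
    the average. Near a point where some horizontal field has a nonzero derivative
    on f, a horizontal segment of length of the order of A ^ 2 leads back to S
    (chart_zero). For small rho the gain A ^ 2 / (8 rho) is larger than this cost,
    which is a contradiction unless q1 = q2 (shorter_competitor, unique_near).

    Horizontal polygons replace curves throughout. A polygon is an admissible curve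
    (cc_dist_poly). Conversely an admissible curve shorter than rho is followed, up
    to an arbitrarily small vertical error, by M steps of length at most rho / M, for
    any large M (cc_dist_discretize); this is the discrete form of constant speed. As
    a small vertical displacement is achieved by a short rectangle (vert_poly), the
    distance is the infimum of the lengths of polygons (cc_dist_lt). This makes it
    continuous, and nearest points exist by compactness (nearest_exists).

    At a point q of S that is not singular some horizontal vector is transverse to
    the kernel of the differential of f (nonsingular_transverse): otherwise this
    kernel would be the horizontal space, and by the implicit function theorem
    (implicit_curve) all of its vectors would be velocities of C1 curves in S. The
    constants above are locally uniform (local_reach), and K is compact. *)

(** * The Euclidean plane and its symplectic form *)

(** Both the horizontal projection of a point and the components of a horizontal
    vector live here. *)
Notation hplane R n := ('rV[R]_n * 'rV[R]_n)%type.

Section HorizontalPlane.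
Context {R : realType} {n : nat}.
Implicit Types (u v w c : hplane R n) (s : R).

Definition dot u v : R :=
  \sum_(i < n) (u.1 ord0 i * v.1 ord0 i + u.2 ord0 i * v.2 ord0 i).

(** The t-component of the horizontal vector with components v at a point over c,
    that is the standard symplectic form with the sign that vfX and vfY induce. *)
Definition om c v : R :=
  \sum_(i < n) (v.1 ord0 i * c.2 ord0 i - v.2 ord0 i * c.1 ord0 i).

(** The Euclidean norm, which measures length; `|v| is the sup norm. *)
Definition en v : R := Num.sqrt (dot v v).

(** The rotation by a right angle in each plane (x_i, y_i): it turns om into a dot
    product, so that Cauchy-Schwarz bounds om as well. *)
Definition hrot v : hplane R n := (- v.2, v.1).

Lemma dotC u v : dot u v = dot v u.
Proof. by apply: eq_bigr => i _; ring. Qed.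

Lemma dotDl u v w : dot (u + v) w = dot u w + dot v w.
Proof. by rewrite -big_split; apply: eq_bigr => i _ /=; rewrite !mxE; ring. Qed.

Lemma dotZl s v w : dot (s *: v) w = s * dot v w.
Proof. by rewrite mulr_sumr; apply: eq_bigr => i _ /=; rewrite !mxE; ring. Qed.

Lemma dotDr u v w : dot w (u + v) = dot w u + dot w v.
Proof. by rewrite dotC dotDl !(dotC w). Qed.

Lemma dotZr s v w : dot w (s *: v) = s * dot w v.
Proof. by rewrite dotC dotZl dotC. Qed.

Lemma dotNl v w : dot (- v) w = - dot v w.
Proof. by rewrite -scaleN1r dotZl mulN1r. Qed.

Lemma dotNr v w : dot w (- v) = - dot w v.
Proof. by rewrite dotC dotNl dotC. Qed.

Definition dotE := (dotDl, dotDr, dotNl, dotNr, dotZl, dotZr).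

Lemma omE c v : om c v = dot (hrot v) c.
Proof. by apply: eq_bigr => i _ /=; rewrite !mxE; ring. Qed.

Lemma omC u v : om u v = - om v u.
Proof. by rewrite -sumrN; apply: eq_bigr => i _; ring. Qed.

Lemma omDl u v w : om (u + v) w = om u w + om v w.
Proof. by rewrite !omE dotDr. Qed.

Lemma omZl s v w : om (s *: v) w = s * om v w.
Proof. by rewrite !omE dotZr. Qed.

Lemma omDr u v w : om w (u + v) = om w u + om w v.
Proof. by rewrite !(omC w) omDl opprD. Qed.

Lemma omZr s v w : om w (s *: v) = s * om w v.
Proof. by rewrite omC omZl omC mulrN opprK. Qed.

Lemma omNl v w : om (- v) w = - om v w.
Proof. by rewrite -scaleN1r omZl mulN1r. Qed.

Lemma omNr v w : om w (- v) = - om w v.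
Proof. by rewrite -scaleN1r omZr mulN1r. Qed.

Lemma omvv v : om v v = 0.
Proof. by have := omC v v; lra. Qed.

Lemma om0l v : om 0 v = 0. Proof. by rewrite -(scale0r 0) omZl mul0r. Qed.
Lemma om0r v : om v 0 = 0. Proof. by rewrite omC om0l oppr0. Qed.

Definition omD := (omDl, omDr, omNl, omNr, omZl, omZr, omvv, om0l, om0r).

Lemma dot_ge0 v : 0 <= dot v v.
Proof. by apply: sumr_ge0 => i _; rewrite addr_ge0 // -expr2 sqr_ge0. Qed.

Lemma dot_eq0 v : dot v v = 0 -> v = 0.
Proof.
move/eqP; rewrite psumr_eq0 => [/allP h|i _]; last first.
  by rewrite addr_ge0 // -expr2 sqr_ge0.
have hh i : v.1 ord0 i = 0 /\ v.2 ord0 i = 0.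
  have := h i (mem_index_enum _); rewrite -!expr2 paddr_eq0 ?sqr_ge0 //.
  by rewrite !sqrf_eq0 => /andP[/eqP -> /eqP ->].
case: v hh {h} => x y /= hh.
by congr pair; apply/rowP => i; rewrite mxE; case: (hh i).
Qed.

Lemma en_ge0 v : 0 <= en v. Proof. exact: sqrtr_ge0. Qed.

Lemma en_sqr v : en v ^+ 2 = dot v v.
Proof. by rewrite sqr_sqrtr // dot_ge0. Qed.

Lemma en0 : en 0 = 0.
Proof. by rewrite /en -(scale0r 0) dotZl mul0r sqrtr0. Qed.

Lemma en_eq0 v : en v = 0 -> v = 0.
Proof. by move=> h; apply: dot_eq0; rewrite -en_sqr h expr0n. Qed.

Lemma enZ s v : en (s *: v) = `|s| * en v.
Proof. by rewrite /en !dotE mulrA sqrtrM ?sqr_ge0 // -expr2 sqrtr_sqr. Qed.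

Lemma enN v : en (- v) = en v.
Proof. by rewrite -scaleN1r enZ normrN1 mul1r. Qed.

Lemma en_hrot v : en (hrot v) = en v.
Proof.
by rewrite /en; congr Num.sqrt; apply: eq_bigr => i _; rewrite /= !mxE; ring.
Qed.

(** Cauchy-Schwarz, from the nonnegativity of the square of the component of u
    orthogonal to v. *)
Lemma dot_le u v : `|dot u v| <= en u * en v.
Proof.
have [v0|v0] := eqVneq (dot v v) 0.
  by rewrite (dot_eq0 v0) -(scale0r 0) dotZr mul0r normr0 mulr_ge0 ?en_ge0.
have vp : 0 < dot v v by rewrite lt0r v0 dot_ge0.
rewrite -(@ler_pXn2r _ 2) ?nnegrE ?mulr_ge0 ?en_ge0 //.
rewrite real_normK ?num_real // exprMn !en_sqr.
have := dot_ge0 (dot v v *: u - dot u v *: v).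
rewrite !dotE (dotC v u) => h.
have : 0 <= dot v v * (dot u u * dot v v - dot u v ^+ 2) by move: h; lra.
by rewrite pmulr_rge0 // subr_ge0.
Qed.

Lemma om_le u v : `|om u v| <= en u * en v.
Proof. by rewrite omE mulrC -(en_hrot v) dot_le. Qed.

Lemma enD u v : en (u + v) <= en u + en v.
Proof.
rewrite -(@ler_pXn2r _ 2) ?nnegrE ?addr_ge0 ?en_ge0 //.
rewrite sqrrD !en_sqr !dotE (dotC v u).
have := dot_le u v; rewrite ler_norml => /andP[_]; lra.
Qed.

Lemma enB u v : en (u - v) <= en u + en v.
Proof. by rewrite -(enN v) enD. Qed.

Lemma norm_le_en v : `|v| <= en v.
Proof.
have aux (x : R) (P : 'I_n -> R) i : (forall j, 0 <= P j) -> x ^+ 2 <= P i ->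
    `|x| <= Num.sqrt (\sum_j P j).
  move=> P0 xP; rewrite -sqrtr_sqr ler_wsqrtr // (le_trans xP) //.
  by rewrite (bigD1 i) //= lerDl sumr_ge0.
have P0 (j : 'I_n) :
    0 <= v.1 ord0 j * v.1 ord0 j + v.2 ord0 j * v.2 ord0 j.
  by rewrite addr_ge0 // -expr2 sqr_ge0.
rewrite prod_normE /= num_ge_max; apply/andP; split.
  rewrite [leLHS]mx_normrE; apply: bigmax_le => [|[a i] _ /=]; first exact: en_ge0.
  rewrite ord1; apply: (aux _ _ i) => //.
  by rewrite -!expr2 lerDl sqr_ge0.
rewrite [leLHS]mx_normrE; apply: bigmax_le => [|[a i] _ /=]; first exact: en_ge0.
rewrite ord1; apply: (aux _ _ i) => //.
by rewrite -!expr2 lerDr sqr_ge0.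
Qed.

Lemma en_le_norm v : en v <= (n.*2)%:R * `|v|.
Proof.
have h1 i : `|v.1 ord0 i| <= `|v|.
  rewrite prod_normE le_max; apply/orP; left.
  rewrite [leRHS]mx_normrE.
  exact: (le_bigmax _ (fun i : _ * _ => `|v.1 i.1 i.2|) (ord0, i)).
have h2 i : `|v.2 ord0 i| <= `|v|.
  rewrite prod_normE le_max; apply/orP; right.
  rewrite [leRHS]mx_normrE.
  exact: (le_bigmax _ (fun i : _ * _ => `|v.2 i.1 i.2|) (ord0, i)).
rewrite -(@ler_pXn2r _ 2) ?nnegrE ?mulr_ge0 ?en_ge0 //.
rewrite en_sqr exprMn.
apply: (@le_trans _ _ (\sum_(i < n) (`|v| ^+ 2 + `|v| ^+ 2))).
  apply: ler_sum => i _; rewrite -!expr2.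
  by apply: lerD; rewrite -real_normK ?num_real // ler_pXn2r ?nnegrE.
rewrite sumr_const card_ord -mulr2n -mulrnA mul2n -[leLHS]mulr_natl.
rewrite ler_wpM2r ?sqr_ge0 // -natrX ler_nat expnS expn1.
by case: (n.*2) => // k; rewrite mulSn leq_addr.
Qed.

End HorizontalPlane.

(** * Horizontal vectors, steps and the speed of a curve *)

Section HorizontalVectors.
Context {R : realType} {n : nat}.
Implicit Types (p q w : heis R n) (v : hplane R n).

(** The horizontal vector at p with components v in the frame of the X_i and Y_i. *)
Definition hv p v : heis R n := (v, om p.1 v).

Lemma theta_om p w : theta p w = w.2 - om p.1 w.1.
Proof. by []. Qed.

Lemma horizontalP p w : horizontal p w <-> w.2 = om p.1 w.1.
Proof.
have eqc (a b : 'I_n -> R) : frame_comb p a b 0 =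
    \sum_(i < n) (a i *: vfX i p + b i *: vfY i p).
  by rewrite /frame_comb scale0r addr0.
split=> [[a [b]]|h].
  rewrite -eqc => e; have [_ _] := frame_combE p a b 0.
  by rewrite -e theta_om => /eqP; rewrite subr_eq0 => /eqP.
exists (cx w), (cy w); rewrite -eqc [LHS](frame_decomp p).
by congr frame_comb; rewrite theta_om h subrr.
Qed.

Lemma horizontal_hv p v : horizontal p (hv p v).
Proof. exact/horizontalP. Qed.

Lemma horizontalE p w : horizontal p w -> w = hv p w.1.
Proof. by move/horizontalP; case: w => v t /= ->. Qed.

Lemma riem_norm_hv p v : riem_norm p (hv p v) = en v.
Proof.
rewrite /riem_norm /riem theta_om /= subrr mul0r addr0.
by rewrite /en /dot.
Qed.

Lemma riem_norm_horizontal p w : horizontal p w -> riem_norm p w = en w.1.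
Proof. by move=> /horizontalE {1}->; rewrite riem_norm_hv. Qed.

(** The end of a horizontal segment; in the group, the product of p by exp v. A
    horizontal polygon is thus encoded by its starting point and its steps, and
    foldl step p vs is its end. *)
Definition step p v : heis R n := p + hv p v.

Lemma stepE p v : step p v = (p.1 + v, p.2 + om p.1 v).
Proof. by []. Qed.

(** Since om v v = 0, a vector that is horizontal at p stays horizontal along the
    Euclidean line that it spans: horizontal segments are Euclidean segments. *)
Lemma hv_line p v s : hv (p + s *: hv p v) v = hv p v.
Proof. by rewrite /hv /= !omD mulr0 addr0. Qed.

(** The length of a polygon, which does not depend on its starting point. *)
Definition plen (vs : seq (hplane R n)) : R := \sum_(v <- vs) en v.

Lemma plen_cat us vs : plen (us ++ vs) = plen us + plen vs.
Proof. exact: big_cat. Qed.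

Lemma plen_rcons vs v : plen (rcons vs v) = plen vs + en v.
Proof. by rewrite -cats1 plen_cat /plen big_seq1. Qed.

Lemma plen_ge0 vs : 0 <= plen vs.
Proof. by apply: sumr_ge0 => v _; exact: en_ge0. Qed.

Lemma en_continuous : continuous (@en R n).
Proof.
move=> v; apply/cvgrPdist_le => /= e e0.
have K0 : 0 < (n.*2)%:R + 1 :> R by rewrite ltr_wpDl.
near=> u.
have dist : `|en v - en u| <= en (v - u).
  rewrite ler_norml lerBlDr lerBrDr addrC lerBlDl.
  have h1 := enD (v - u) u; have h2 := enD (u - v) v.
  rewrite !subrK -[en (u - v)]enN opprB in h1 h2.
  by apply/andP; split; move: h1 h2; lra.
apply: (le_trans dist); apply: (le_trans (en_le_norm _)).
apply: (@le_trans _ _ ((n.*2%:R + 1) * `|v - u|)).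
  by rewrite ler_wpM2r // lerDl.
rewrite mulrC -ler_pdivlMr //; near: u.
by apply: cvgr_dist_le => //; rewrite divr_gt0.
Unshelve. all: by end_near. Qed.

End HorizontalVectors.

Section Speed.
Context {R : realType} {n : nat}.
Implicit Types (g h : R -> heis R n) (a b x y s : R).
Local Notation mu := (@lebesgue_measure R).

Definition speed g s := riem_norm (g s) (derive1 g s).

Lemma speed_ge0 g s : 0 <= speed g s.
Proof. exact: sqrtr_ge0. Qed.

Lemma smooth_derivable h : smooth h -> forall s, derivable h s 1.
Proof. by move=> sh s; exact: (sh 0%N). Qed.

Lemma derivable1_continuous {V : normedModType R} (h : R -> V) s :
  derivable h s 1 -> {for s, continuous h}.
Proof. by move=> d; apply/differentiable_continuous/derivable1_diffP. Qed.

Lemma smooth_derive1_continuous h : smooth h -> continuous (derive1 h).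
Proof.
by move=> sh s; apply: derivable1_continuous; exact: (sh 1%N).
Qed.

Lemma hspeed_continuous h : smooth h -> continuous (fun s => en (derive1 h s).1).
Proof.
move=> sh s; apply: continuous_comp; last exact: en_continuous.
apply: continuous_comp; [exact: smooth_derive1_continuous|exact: cvg_fst].
Qed.

Lemma piece_derive1 {V : normedModType R} (g h : R -> V) x y s :
  {in `[x, y], g =1 h} -> (forall s, derivable h s 1) ->
  s \in `]x, y[ -> derivable g s 1 /\ derive1 g s = derive1 h s.
Proof.
move=> gh dh sxy.
have gnear : {near s, h =1 g}.
  apply: filterS (near_in_itvoo sxy) => z zxy; apply/esym/gh.
  exact: subset_itv_oo_cc.
split; first exact: near_eq_derivable (dh s).
by rewrite !derive1E; apply/esym/near_eq_derive.
Qed.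

Lemma piece_speed g x y : smooth_on x y g ->
  (forall s, s \in `]x, y[ -> derivable g s 1 -> horizontal (g s) (derive1 g s)) ->
  exists h, [/\ smooth h, {in `[x, y], g =1 h},
     forall s, s \in `]x, y[ -> horizontal (h s) (derive1 h s) &
     forall s, s \in `]x, y[ -> speed g s = en (derive1 h s).1].
Proof.
move=> [h sh gh] hor; exists h.
have hh s : s \in `]x, y[ -> horizontal (h s) (derive1 h s).
  move=> sxy; have [d e] := piece_derive1 gh (smooth_derivable sh) sxy.
  have := hor s sxy d; rewrite e gh //; exact: subset_itv_oo_cc.
split=> // s sxy; have [d e] := piece_derive1 gh (smooth_derivable sh) sxy.
rewrite /speed e gh; last exact: subset_itv_oo_cc.
exact/riem_norm_horizontal/hh.
Qed.

Lemma piece_measurable g x y : smooth_on x y g ->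
  (forall s, s \in `]x, y[ -> derivable g s 1 -> horizontal (g s) (derive1 g s)) ->
  measurable_fun `[x, y] (speed g).
Proof.
move=> sg hg; have [h [sh _ _ E]] := piece_speed sg hg.
apply/measurable_fun_itv_bndo_bndcP; apply/measurable_fun_itv_obnd_cbndP.
apply: (eq_measurable_fun (fun s => en (derive1 h s).1)).
  by move=> s; rewrite inE => sxy; rewrite E.
apply: measurable_funTS; apply: continuous_measurable_fun.
exact: hspeed_continuous.
Qed.

Lemma itv_ccU a c b : a <= c -> c <= b ->
  `[a, b]%classic = `[a, c] `|` `]c, b] :> set R.
Proof.
move=> ac cb; apply/seteqP; split=> z /=; rewrite !in_itv /=.
  by move=> /andP[az zb]; have [zc|zc] := leP z c; [left|right]; apply/andP.
case=> /andP[az zb]; apply/andP; split=> //.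
  exact: le_trans cb.
by rewrite (le_trans ac) // ltW.
Qed.

Lemma integral_itv_split (F : R -> R) a c b : a <= c -> c <= b ->
  measurable_fun `[a, c] F -> measurable_fun `[c, b] F ->
  (forall s, 0 <= F s) ->
  measurable_fun `[a, b] F /\
  (\int[mu]_(s in `[a, b]) (F s)%:E =
  \int[mu]_(s in `[a, c]) (F s)%:E + \int[mu]_(s in `[c, b]) (F s)%:E)%E.
Proof.
move=> ac cb m1 m2 F0.
have m2' : measurable_fun `]c, b] F.
  by apply: measurable_funS m2 => //; apply: subset_itvr; rewrite bnd_simp.
have m : measurable_fun (`[a, c] `|` `]c, b]) F.
  by apply/measurable_funU.
split; first by rewrite (itv_ccU ac cb).
rewrite (itv_ccU ac cb) ge0_integral_setU //=.
- congr (_ + _)%E; apply: integral_itv_obnd_cbnd; exact/measurable_EFinP.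
- exact/measurable_EFinP.
- by move=> s _; rewrite lee_fin.
- apply/disj_set2P/seteqP; split=> // z /= [].
  rewrite !in_itv /= => /andP[_ zc] /andP[cz _].
  by move: (lt_le_trans cz zc); rewrite ltxx.
Qed.

Lemma curve_measurable g a b : piecewise_smooth a b g ->
  horizontal_curve a b g -> measurable_fun `[a, b] (speed g).
Proof.
move=> [s]; elim: s a => [|x s ih] a [pa la] hs hg.
  by move: la => /= /eqP ->; rewrite set_itv1; exact: measurable_fun_set1.
move: pa => /= /andP[ax px].
have ip : itv_partition x b s by split.
have xb := itv_partition_le ip.
have sub1 : {subset `]a, x[ <= `]a, b[}.
  by apply: subset_itvl; rewrite bnd_simp.
have sub2 : {subset `]x, b[ <= `]a, b[}.
  by apply: subset_itvr; rewrite bnd_simp ltW.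
have m1 : measurable_fun `[a, x] (speed g).
  apply: piece_measurable; first exact: (hs 0%N).
  by move=> z /sub1; exact: hg.
have m2 : measurable_fun `[x, b] (speed g).
  apply: ih => //; first by move=> i; exact: (hs i.+1).
  by move=> z /sub2; exact: hg.
by have [] := integral_itv_split (ltW ax) xb m1 m2 (@speed_ge0 g).
Qed.

End Speed.

(** * Horizontal polygons are admissible curves *)

Section DifferenceQuotients.
Context {R : realType} {V : normedModType R}.
Implicit Types (f : R -> V) (s : R) (l q w : V).

Lemma is_derive1P f s l :
  is_derive s 1 f l <-> h^-1 *: (f (h + s) - f s) @[h --> 0^'] --> l.
Proof.
have E : (fun h : R => h^-1 *: (f (h + s) - f s)) =
         (fun h : R => h^-1 *: ((f \o shift s) (h *: 1) - f s)).
  by apply/funext => h; rewrite /= /GRing.scale /= mulr1.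
rewrite E; split=> [[d <-]|c]; first exact: d.
by apply: DeriveDef; [apply/cvg_ex; exists l|exact: cvg_lim c].
Qed.

Lemma is_derive_affine q w b s :
  is_derive s 1 (fun s => q + (s - b) *: w) w.
Proof.
apply/is_derive1P; apply: cvg_near_cst; near=> h.
have h0 : h != 0 by near: h; exact: (nbhs_dnbhs_neq (0:R)).
rewrite opprD addrACA subrr add0r -scalerBl.
have -> : h + s - b - (s - b) = h by ring.
by rewrite scalerA mulVf // scale1r.
Unshelve. all: by end_near. Qed.

Lemma derive1_affine q w b :
  derive1 (fun s => q + (s - b) *: w) = cst w.
Proof.
by apply/funext => s; rewrite derive1E; have [_ ->] := is_derive_affine q w b s.
Qed.

(** At a corner between two pieces a curve may happen to be differentiable; this
    identifies its derivative there, whose horizontality is then known. *)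
Lemma right_derive1 f l s : derivable f s 1 ->
  h^-1 *: (f (h + s) - f s) @[h --> 0^'+] --> l -> derive1 f s = l.
Proof.
move=> d c.
have D : is_derive s 1 f (derive1 f s) by rewrite derive1E; exact: derivableP.
move/is_derive1P : D => D.
apply/esym; apply: (cvg_unique _ c) => //.
apply: cvg_trans D; apply: cvg_fmap2.
by apply: within_subset => r /= r0; rewrite gt_eqF.
Qed.

End DifferenceQuotients.

Section Polygons.
Context {R : realType} {n : nat}.
Implicit Types (p q w : heis R n) (v : hplane R n) (g : R -> heis R n).
Local Notation mu := (@lebesgue_measure R).

Lemma smooth_affine q w b : smooth (fun s => q + (s - b) *: w).
Proof.
move=> k s; case: k => [|k]; first by have [] := is_derive_affine q w b s.
have [c ->] : exists c, derive1n k.+1 (fun s => q + (s - b) *: w) = cst c.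
  elim: k => [|k [c ih]]; first by exists w; rewrite derive1n1 derive1_affine.
  by exists 0; rewrite derive1nS ih; apply/funext => z; rewrite derive1_cst.
exact: derivable_cst.
Qed.

(** The set of lengths over which cc_dist takes an infimum. *)
Definition joins p q (l : \bar R) := exists a b g,
  [/\ a < b, piecewise_smooth a b g, horizontal_curve a b g,
      g a = p /\ g b = q & l = riem_length a b g].

Lemma segment_length q v (b : R) :
  (\int[mu]_(s in `[b, (b + 1)%R])
     (speed (fun s => q + (s - b) *: hv q v) s)%:E = (en v)%:E)%E.
Proof.
rewrite (eq_integral (cst (en v)%:E)); last first.
  move=> s _; rewrite /speed derive1_affine /= -(hv_line q v (s - b)).
  by rewrite riem_norm_hv.
rewrite integral_cst //= lebesgue_measure_itv /= lte_fin ltrDl ltr01.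
by rewrite -EFinB addrAC subrr add0r mule1.
Qed.

(** The curve is prolonged by a segment over a unit interval of parameters. At the
    corner a derivative, if there is one, is the direction of the segment. *)
Lemma joins_step p q v l : joins p q l -> joins p (step q v) (l + (en v)%:E)%E.
Proof.
move=> [a [b [g [ab [s [ps ls] sg] hg [ga gb] ->]]]].
pose line s := q + (s - b) *: hv q v.
pose g1 s := if s <= b then g s else line s.
have bb1 : b < b + 1 by rewrite ltrDl.
have gl : {in `[b, b + 1], g1 =1 line}.
  move=> z; rewrite in_itv /= => /andP[bz _]; rewrite /g1 /line.
  case: leP => // zb; have -> : z = b by apply/eqP; rewrite eq_le zb bz.
  by rewrite subrr scale0r addr0 gb.
have gg z : z <= b -> g1 z = g z by rewrite /g1 => ->.
have nearl z : z < b -> {near z, g1 =1 g}.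
  move=> zb; near=> y; apply: gg; apply: ltW; near: y; exact: lt_nbhsl.
have dline z : z \in `]b, b + 1[ -> derive1 g1 z = hv q v.
  move=> zI; have [_ ->] := piece_derive1 gl
    (fun z => @ex_derive _ _ _ _ _ _ _ (is_derive_affine q (hv q v) b z)) zI.
  by rewrite derive1_affine.
have hor : horizontal_curve a (b + 1) g1.
  move=> z; rewrite in_itv /= => /andP[az zb1] dz.
  have [zb|bz|zb] := ltgtP z b.
  - rewrite gg ?(ltW zb) //.
    have dg : derivable g z 1 by exact: near_eq_derivable (nearl z zb) dz.
    rewrite derive1E (near_eq_derive _ (nearl z zb)) -derive1E.
    by apply: hg => //; rewrite in_itv /= az zb.
  - rewrite dline ?in_itv /= ?bz // gl ?in_itv /= ?(ltW bz) ?(ltW zb1) //.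
    rewrite /line -(hv_line q v (z - b)); exact: horizontal_hv.
  - rewrite zb in dz *.
    rewrite (@right_derive1 _ _ _ (hv q v)) //.
      by rewrite gg // gb; exact: horizontal_hv.
    apply: cvg_near_cst; near=> h.
    have h0 : 0 < h by [].
    have h1 : h <= 1 by near: h; exact: nbhs_right_le.
    rewrite (gg b) // gl ?in_itv /= ?lerDr ?(ltW h0) ?[h + b]addrC ?lerD2l //.
    rewrite /line gb [q + _]addrC addrK addrAC subrr add0r.
    by rewrite scalerA mulVf ?scale1r // gt_eqF.
have psg : piecewise_smooth a (b + 1) g1.
  exists (rcons s (b + 1)).
    split; last by rewrite last_rcons.
    by rewrite rcons_path ps (eqP ls) bb1.
  move=> i; rewrite size_rcons ltnS leq_eqVlt => /orP[/eqP ->|ib].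
    rewrite nth_rcons ltnn eqxx -rcons_cons nth_rcons /= ltnSn.
    rewrite -last_nth (eqP ls); exists line => //; exact: smooth_affine.
  rewrite nth_rcons ib -rcons_cons nth_rcons /= ltnS (ltnW ib).
  rewrite (set_nth_default b (b + 1)) ?ltnS ?(ltnW ib) //.
  rewrite (set_nth_default b (b + 1) ib).
  have [h sh gh] := sg i ib; exists h => // z zI; rewrite -gh // gg //.
  move: zI; rewrite in_itv /= => /andP[_ /le_trans]; apply.
  have ip : itv_partition a b s by split.
  exact: (@itv_partition_nth_le _ _ a b s i.+1).
exists a, (b + 1), g1; split=> //.
- exact: lt_trans ab bb1.
- rewrite gg ?ltW // ga gl ?in_itv /= ?(ltW bb1) ?lexx //.
  by rewrite /line addrAC subrr add0r scale1r.
have sub1 : {subset `]a, b[ <= `]a, b + 1[}.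
  by apply: subset_itvl; rewrite bnd_simp ltW.
have m := curve_measurable psg hor.
have mab : measurable_fun `[a, b] (speed g1).
  by apply: measurable_funS m => //; apply: subset_itvl; rewrite bnd_simp ltW.
have mbb : measurable_fun `[b, b + 1] (speed g1).
  by apply: measurable_funS m => //; apply: subset_itvr; rewrite bnd_simp ltW.
have [_ split] := integral_itv_split (ltW ab) (ltW bb1) mab mbb (@speed_ge0 _ _ g1).
have mg : measurable_fun `]a, b[ (speed g).
  apply: measurable_funS (curve_measurable _ hg) => //.
    exact: subset_itv_oo_cc.
  by exists s.
have E1 : (\int[mu]_(z in `[a, b]) (speed g z)%:E =
           \int[mu]_(z in `[a, b]) (speed g1 z)%:E)%E.
  apply: (@eq_integral_itv_bounded _ a b (speed g1) (speed g)); first exact: mg.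
    by apply: measurable_funS mab => //; exact: subset_itv_oo_cc.
  move=> z; rewrite in_itv /= => /andP[_ zb].
  have dE : derive1 g1 z = derive1 g z.
    by rewrite !derive1E (near_eq_derive _ (nearl z zb)).
  by rewrite /speed dE (gg z (ltW zb)).
have lE : speed line = cst (en v).
  apply/funext => z; rewrite /speed derive1_affine /= -(hv_line q v (z - b)).
  by rewrite riem_norm_hv.
have E2 : (\int[mu]_(z in `[b, (b + 1)%R]) (speed line z)%:E =
           \int[mu]_(z in `[b, (b + 1)%R]) (speed g1 z)%:E)%E.
  apply: (@eq_integral_itv_bounded _ b (b + 1) (speed g1) (speed line)).
  - by rewrite lE; apply: measurable_funTS.
  - by apply: measurable_funS mbb; [exact: measurable_itv|exact: subset_itv_oo_cc].
  - move=> z zI; rewrite lE /cst /speed (dline z zI).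
    rewrite gl; last exact: subset_itv_oo_cc.
    by rewrite -(hv_line q v (z - b)) riem_norm_hv.
exact: (etrans (congr2 adde E1 (etrans (esym (segment_length q v b)) E2))
  (esym split)).
Unshelve. all: by end_near. Qed.

Lemma joins_refl p : joins p p 0.
Proof.
exists 0, 1, (cst p); split=> //.
- exists [:: 1]; first exact: itv_partition1.
  case=> // _; exists (cst p) => //.
  have -> : cst p = (fun s : R => p + (s - 0) *: 0).
    by apply/funext => s; rewrite scaler0 addr0.
  exact: smooth_affine.
- move=> s _ _; rewrite derive1_cst; apply/horizontalP => /=.
  by rewrite om0r.
- rewrite /riem_length (eq_integral (cst 0%E)) ?integral0 // => s _.
  rewrite derive1_cst (_ : 0 = hv p 0) ?riem_norm_hv ?en0 //.
  by rewrite /hv om0r.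
Qed.

Lemma joins_poly p vs : joins p (foldl step p vs) (plen vs)%:E.
Proof.
elim/last_ind: vs => [|vs v ih]; first by rewrite /plen big_nil; exact: joins_refl.
by rewrite foldl_rcons plen_rcons EFinD; exact: joins_step.
Qed.

Lemma cc_dist_poly p vs : (cc_dist p (foldl step p vs) <= (plen vs)%:E)%E.
Proof. by apply: ereal_inf_lbound; exact: joins_poly. Qed.

End Polygons.

(** * Admissible curves are close to polygons with short steps *)

Section OneVariable.
Context {R : realType}.
Implicit Types (f F : R -> R) (a b x y s : R).
Local Notation mu := (@lebesgue_measure R).

(** Applied to the speed, this gives the arclength of a smooth piece. *)
Lemma primitive_on f a b : a < b -> continuous f ->
  exists F, (forall s, s \in `[a, b] -> is_derive s 1 F (f s)) /\
    (\int[mu]_(s in `[a, b]) (f s)%:E = (F b - F a)%:E)%E.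
Proof.
move=> ab cf.
have fi x y : mu.-integrable `[x, y] (EFin \o f).
  apply: continuous_compact_integrable; first exact: segment_compact.
  exact: continuous_subspaceT.
pose F x : R := \int[mu]_(t in `[(a - 1)%R, x]) f t.
have dF s : s \in `[a, b] -> is_derive s 1 F (f s).
  rewrite in_itv /= => /andP[as_ sb].
  have s1 : s < b + 1 by rewrite (le_lt_trans sb) // ltrDl.
  have a1 : a - 1 < s by rewrite (lt_le_trans _ as_) // gtrDl oppr_lt0.
  have [dF <-] := continuous_FTC1_closed s1 (fi _ _) a1 (cf s).
  by rewrite derive1E; exact: derivableP.
exists F; split=> //; rewrite EFinB; apply: continuous_FTC2 => //.
- exact: continuous_subspaceT.
- split.
  + by move=> s /subset_itv_oo_cc /dF[].
  + apply: cvg_at_right_filter; apply: derivable1_continuous.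
    by have [] := dF a; rewrite ?in_itv //= lexx ltW.
  + apply: cvg_at_left_filter; apply: derivable1_continuous.
    by have [] := dF b; rewrite ?in_itv //= lexx ltW.
- by move=> s /subset_itv_oo_cc /dF[_ <-]; rewrite derive1E.
Qed.

Lemma derive_ge0_le (G dG : R -> R) x y : x <= y ->
  (forall s, s \in `[x, y] -> is_derive s 1 G (dG s)) ->
  (forall s, s \in `]x, y[ -> 0 <= dG s) -> G x <= G y.
Proof.
move=> xy DG dG0; apply: (@ger0_derive1_le_cc _ G x y) => //.
- by move=> s /subset_itv_oo_cc /DG[].
- move=> s sI; have [_ e] := DG s (subset_itv_oo_cc sI).
  by rewrite derive1E e dG0.
- by apply: derivable_within_continuous => s /DG[].
- by rewrite in_itv /= lexx.
- by rewrite in_itv /= lexx xy.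
Qed.

(** The mean value inequality with a primitive in the place of a uniform bound. *)
Lemma increment_le F f (df dF : R -> R) x y : x <= y ->
  (forall s, s \in `[x, y] -> is_derive s 1 f (df s)) ->
  (forall s, s \in `[x, y] -> is_derive s 1 F (dF s)) ->
  (forall s, s \in `]x, y[ -> `|df s| <= dF s) ->
  `|f y - f x| <= F y - F x.
Proof.
move=> xy Df DF dd.
have h1 : (F - f) x <= (F - f) y.
  apply: (derive_ge0_le (dG := dF - df) xy) => [s sI|s /dd].
    by apply: is_deriveB; [exact: DF|exact: Df].
  by rewrite ler_norml => /andP[_]; rewrite !fctE; lra.
have h2 : (F + f) x <= (F + f) y.
  apply: (derive_ge0_le (dG := dF + df) xy) => [s sI|s /dd].
    by apply: is_deriveD; [exact: DF|exact: Df].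
  by rewrite ler_norml => /andP[+ _]; rewrite !fctE; lra.
by move: h1 h2; rewrite !fctE /= ler_norml => h1 h2; apply/andP; split; lra.
Qed.

Lemma is_derive_mull (k : R) F s d : is_derive s 1 F d ->
  is_derive s 1 (fun x => k * F x) (k * d).
Proof. exact: is_deriveZ. Qed.

Lemma is_derive_linear {V : normedModType R} (l : V -> R) (f : R -> V) s (w : V) :
  (forall r u v, l (r *: u + v) = r * l u + l v) ->
  (exists K, forall v, `|l v| <= K * `|v|) ->
  is_derive s 1 f w -> is_derive s 1 (l \o f) (l w).
Proof.
move=> lin [K lK] /is_derive1P D; apply/is_derive1P.
have l0 : l 0 = 0 by have := lin 1 0 0; rewrite scaler0 addr0; lra.
have lZ r u : l (r *: u) = r * l u by rewrite -[r *: u]addr0 lin l0 addr0.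
have lB u v : l (u - v) = l u - l v.
  by rewrite addrC -scaleN1r lin mulN1r addrC.
have lc : {for w, continuous l}.
  apply/cvgrPdist_le => /= e e0.
  have K0 : 0 < `|K| + 1 by rewrite ltr_wpDl.
  near=> u; rewrite -lB (le_trans (lK _)) //.
  apply: (@le_trans _ _ ((`|K| + 1) * `|w - u|)).
    by rewrite ler_wpM2r // (le_trans (ler_norm _)) // lerDl.
  rewrite mulrC -ler_pdivlMr //; near: u.
  by apply: cvgr_dist_le => //; rewrite divr_gt0.
have -> : (fun h : R => h^-1 *: ((l \o f) (h + s) - (l \o f) s)) =
          (fun h : R => l (h^-1 *: (f (h + s) - f s))).
  by apply/funext => h; rewrite /= lZ lB.
exact: continuous_cvg.
Unshelve. all: by end_near. Qed.

End OneVariable.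

Section CoordinateDerivatives.
Context {R : realType} {n : nat}.
Implicit Types (h : R -> heis R n) (w : heis R n) (c e : hplane R n) (s : R).

Lemma norm1_le w : `|w.1| <= `|w|.
Proof. by rewrite [leRHS]prod_normE le_max lexx. Qed.

Lemma norm2_le w : `|w.2| <= `|w|.
Proof. by rewrite [leRHS]prod_normE le_max lexx orbT. Qed.

Lemma en1_le w : en w.1 <= (n.*2)%:R * `|w|.
Proof. by rewrite (le_trans (en_le_norm _)) // ler_wpM2l // norm1_le. Qed.

Lemma is_derive_dot e h s w : is_derive s 1 h w ->
  is_derive s 1 (fun s => dot e (h s).1) (dot e w.1).
Proof.
apply: (is_derive_linear (l := fun w : heis R n => dot e w.1)) => [r u v|].
  by rewrite /= dotDr dotZr.
exists (en e * (n.*2)%:R) => v; rewrite (le_trans (dot_le _ _)) // -mulrA.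
by rewrite ler_wpM2l ?en_ge0 // en1_le.
Qed.

Lemma is_derive_om c h s w : is_derive s 1 h w ->
  is_derive s 1 (fun s => om c (h s).1) (om c w.1).
Proof.
apply: (is_derive_linear (l := fun w : heis R n => om c w.1)) => [r u v|].
  by rewrite /= omDr omZr.
exists (en c * (n.*2)%:R) => v; rewrite (le_trans (om_le _ _)) // -mulrA.
by rewrite ler_wpM2l ?en_ge0 // en1_le.
Qed.

Lemma is_derive_ct h s w : is_derive s 1 h w ->
  is_derive s 1 (fun s => (h s).2) w.2.
Proof.
apply: (is_derive_linear (l := fun w : heis R n => w.2)) => [r u v|] //.
by exists 1 => v; rewrite mul1r norm2_le.
Qed.

End CoordinateDerivatives.

Section Discretization.
Context {R : realType} {n : nat}.
Implicit Types (p q : heis R n) (v : hplane R n) (g h : R -> heis R n).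
Implicit Types (vs : seq (hplane R n)) (eps tau : R).
Local Notation mu := (@lebesgue_measure R).

Definition vert tau : heis R n := (0, tau).

Lemma vertD s t : vert s + vert t = vert (s + t).
Proof. by rewrite /vert; congr pair; exact: addr0. Qed.

Lemma vert0 : vert 0 = 0. Proof. by []. Qed.

(** Vertical translations are central, so that the errors in t made along a curve
    add up at its end. *)
Lemma step_vert p tau v : step (p + vert tau) v = step p v + vert tau.
Proof.
rewrite !stepE; congr pair; rewrite /= !addr0 //.
by rewrite addrAC.
Qed.

Lemma foldl_step_vert p tau vs :
  foldl step (p + vert tau) vs = foldl step p vs + vert tau.
Proof. by elim: vs p => //= v vs ih p; rewrite step_vert ih. Qed.

Lemma step0 p : step p 0 = p.
Proof. by rewrite stepE om0r !addr0; case: p. Qed.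

Lemma foldl_step_nseq0 p k : foldl step p (nseq k 0) = p.
Proof. by elim: k p => //= k ih p; rewrite step0. Qed.

Lemma en_le_of_dot v (b : R) : 0 <= b -> dot v v <= en v * b -> en v <= b.
Proof.
move=> b0; rewrite -en_sqr expr2.
have := en_ge0 v; rewrite le_eqVlt => /orP[/eqP <- //|v0].
by rewrite ler_pM2l.
Qed.

Section Piece.
Context (h : R -> heis R n) (a b : R) (sh : smooth h)
  (hor : forall s, s \in `]a, b[ -> horizontal (h s) (derive1 h s))
  (F : R -> R)
  (DF : forall s : R, s \in `[a, b] -> is_derive s 1 F (en (derive1 h s).1)).

Let Dh (s : R) : is_derive s 1 h (derive1 h s).
Proof. by rewrite derive1E; apply: derivableP; exact: smooth_derivable. Qed.

(** Replacing an arc of length E by its chord costs at most E ^ 2 in the coordinate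
    t. Indeed along the arc t - om c_x c has the derivative om (c - c_x) c', where c
    is the horizontal projection; its first factor is at most E, and the integral
    of the norm of the second is E. *)
Lemma arclength_increment x y : a <= x -> x <= y -> y <= b ->
  [/\ 0 <= F y - F x, en ((h y).1 - (h x).1) <= F y - F x &
   `|(h y).2 - (h x).2 - om (h x).1 ((h y).1 - (h x).1)| <= (F y - F x) ^+ 2].
Proof.
move=> ax xy yb.
have sub (u z : R) : x <= u -> z <= y -> {subset `[u, z] <= `[a, b]}.
  move=> xu zy; apply: subset_itv; rewrite bnd_simp.
    exact: le_trans xu. exact: le_trans yb.
have incr_ge0 (u z : R) : x <= u -> u <= z -> z <= y -> 0 <= F z - F u.
  move=> xu uz zy.
  rewrite subr_ge0.
  have DFuz s : s \in `[u, z] -> is_derive s 1 F (en (derive1 h s).1).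
    by move=> sI; apply: DF; exact: sub sI.
  by apply: (derive_ge0_le uz DFuz) => s _; exact: en_ge0.
have incr_en (z : R) : x <= z -> z <= y -> en ((h z).1 - (h x).1) <= F z - F x.
  move=> xz zy; set e := _ - _.
  apply: en_le_of_dot; first exact: incr_ge0.
  have D1 s (sI : s \in `[x, z]) :
    is_derive s 1 (fun s => dot e (h s).1) (dot e (derive1 h s).1).
    exact: is_derive_dot.
  have D2 s (sI : s \in `[x, z]) :
    is_derive s 1 (fun s => en e * F s) (en e * en (derive1 h s).1).
    by apply: is_derive_mull; apply: DF; exact: sub sI.
  have : `|dot e (h z).1 - dot e (h x).1| <= en e * F z - en e * F x.
    by refine (increment_le xz D1 D2 _) => s _; exact: dot_le.
  by rewrite -mulrBr -dotNr -dotDr -/e ger0_norm ?dot_ge0.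
split; [exact: incr_ge0|exact: incr_en|].
pose psi s := (h s).2 - om (h x).1 (h s).1.
have psiE : psi y - psi x =
    (h y).2 - (h x).2 - om (h x).1 ((h y).1 - (h x).1).
  by rewrite /psi omDr omNr omvv; ring.
rewrite -psiE expr2 mulrBr.
have D1 s (sI : s \in `[x, y]) :
  is_derive s 1 psi ((derive1 h s).2 - om (h x).1 (derive1 h s).1).
  by apply: is_deriveB; [exact: is_derive_ct|exact: is_derive_om].
have D2 s (sI : s \in `[x, y]) : is_derive s 1 (fun s => (F y - F x) * F s)
    ((F y - F x) * en (derive1 h s).1).
  by apply: is_derive_mull; apply: DF; exact: sub sI.
refine (increment_le xy D1 D2 _) => s sI.
have sI' : s \in `]a, b[.
    by move: sI; apply: subset_itv; rewrite bnd_simp.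
  have /andP[xs sy] : x <= s <= y by move: (subset_itv_oo_cc sI); rewrite in_itv.
  have /horizontalP -> := hor sI'; rewrite -omNl -omDl.
  rewrite (le_trans (om_le _ _)) // ler_wpM2r ?en_ge0 //.
  rewrite (le_trans (incr_en s xs sy)) // lerD2r -subr_ge0.
  exact: incr_ge0.
Qed.

(** The intermediate value theorem cuts the piece at arclengths differing by at most
    eps. Each chord is then at most eps and each error in t at most eps ^ 2. *)
Lemma piece_poly_aux eps k : 0 < eps -> forall x, x \in `[a, b] ->
  F x - F a <= k%:R * eps ->
  exists vs tau, [/\ size vs = k, {in vs, forall v, en v <= eps},
    foldl step (h a) vs = h x + vert tau & `|tau| <= k%:R * eps ^+ 2].
Proof.
move=> e0; elim: k => [|k ih] x xI Fx.
  have /andP[ax xb] : a <= x <= b by move: xI; rewrite in_itv.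
  rewrite mul0r in Fx.
  have [F0 ec et] := arclength_increment (lexx a) ax xb.
  have FE : F x - F a = 0 by apply/eqP; rewrite eq_le Fx F0.
  rewrite FE expr0n /= in ec et.
  have c0 : (h x).1 - (h a).1 = 0.
    by apply: en_eq0; apply/eqP; rewrite eq_le ec en_ge0.
  rewrite c0 om0r subr0 normr_le0 subr_eq0 in et.
  exists [::], 0; split=> //=; last by rewrite normr0 mul0r.
  rewrite vert0 addr0 [LHS]surjective_pairing [RHS]surjective_pairing.
  by move/eqP : et => ->; move/eqP : c0; rewrite subr_eq0 => /eqP ->.
have /andP[ax xb] : a <= x <= b by move: xI; rewrite in_itv.
have [y yI [Fy Fxy]] : exists2 y, y \in `[a, x] &
    F y - F a <= k%:R * eps /\ F x - F y <= eps.
  have [Fxk|kFx] := leP (F x - F a) (k%:R * eps).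
    exists x; first by rewrite in_itv /= ax lexx.
    by split; [exact: Fxk|rewrite subrr ltW].
  have cF : {within `[a, x], continuous F}.
    apply: derivable_within_continuous => s sI.
    have sI' : s \in `[a, b].
      by move: sI; apply: subset_itv; rewrite bnd_simp.
    by have [] := DF sI'.
  have ke : 0 <= k%:R * eps by rewrite mulr_ge0 // ltW.
  have [|y yI Fy] := @IVT _ F a x (F a + k%:R * eps) ax cF.
    rewrite ge_min le_max; apply/andP; split; apply/orP.
      by left; rewrite lerDl.
    by right; move: kFx; lra.
  exists y => //; rewrite Fy; split; first lra.
  by move: Fx; rewrite -natr1; lra.
have /andP[ay yx] : a <= y <= x by move: yI; rewrite in_itv.
have yI' : y \in `[a, b] by rewrite in_itv /= ay (le_trans yx).
have [vs [tau [sz le ends tle]]] := ih y yI' Fy.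
have [F0 ec et] := arclength_increment ay yx xb.
exists (rcons vs ((h x).1 - (h y).1)),
  (tau + ((h y).2 - (h x).2 + om (h y).1 ((h x).1 - (h y).1))).
split.
- by rewrite size_rcons sz.
- move=> v; rewrite mem_rcons inE => /orP[/eqP ->|/le//].
  exact: le_trans Fxy.
- rewrite foldl_rcons ends step_vert stepE; congr pair => /=.
    by rewrite !addr0 addrC subrK.
  by ring.
- rewrite (le_trans (ler_normD _ _)) // -natr1 mulrDl mul1r lerD //.
  have -> : (h y).2 - (h x).2 + om (h y).1 ((h x).1 - (h y).1) =
     - ((h x).2 - (h y).2 - om (h y).1 ((h x).1 - (h y).1)) by ring.
  rewrite normrN.
  by rewrite (le_trans et) // ler_pXn2r // nnegrE ltW.
Qed.

End Piece.

Lemma piece_poly g x y : x < y -> smooth_on x y g ->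
  (forall s, s \in `]x, y[ -> derivable g s 1 -> horizontal (g s) (derive1 g s)) ->
  exists l, riem_length x y g = l%:E /\ forall eps, 0 < eps ->
    exists vs tau, [/\ (size vs)%:R * eps <= l + eps,
      {in vs, forall v, en v <= eps},
      foldl step (g x) vs = g y + vert tau &
      `|tau| <= (size vs)%:R * eps ^+ 2].
Proof.
move=> xy sg hg; have [h [sh gh hor E]] := piece_speed sg hg.
have [F [DF FE]] := primitive_on xy (hspeed_continuous sh).
exists (F y - F x); split.
  rewrite -FE; apply: (@eq_integral_itv_bounded _ x y _ (speed g)).
  - apply: measurable_funS (piece_measurable sg hg); first exact: measurable_itv.
    exact: subset_itv_oo_cc.
  - apply: measurable_funTS; apply: continuous_measurable_fun.
    exact: hspeed_continuous.
  - by move=> s; exact: E.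
move=> eps e0.
have xI : x \in `[x, y] by rewrite in_itv /= lexx ltW.
have yI : y \in `[x, y] by rewrite in_itv /= lexx ltW.
have [F0 _ _] := arclength_increment sh hor DF (lexx x) (ltW xy) (lexx y).
have Fe : 0 <= (F y - F x) / eps by rewrite divr_ge0 // ltW.
have /andP[lo hi] := Num.Theory.truncn_itv Fe.
have hi' : F y - F x <= (Num.truncn ((F y - F x) / eps)).+1%:R * eps.
  by rewrite -ler_pdivrMr // ltW.
have [vs [tau [sz le ends tle]]] := piece_poly_aux sh hor DF e0 yI hi'.
exists vs, tau; rewrite sz !gh //; split=> //.
by rewrite -natr1 mulrDl mul1r lerD2r -ler_pdivlMr.
Qed.

(** Each of the k smooth pieces needs at most one step more than its length allows. *)
Lemma curve_poly g a b : piecewise_smooth a b g -> horizontal_curve a b g ->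
  exists k l, riem_length a b g = l%:E /\ forall eps, 0 < eps ->
    exists vs tau, [/\ (size vs)%:R * eps <= l + k%:R * eps,
      {in vs, forall v, en v <= eps},
      foldl step (g a) vs = g b + vert tau &
      `|tau| <= (size vs)%:R * eps ^+ 2].
Proof.
move=> [s]; elim: s a => [|x s ih] a [pa la] hs hg.
  move: la => /= /eqP ->; exists 0%N, 0; split.
    by rewrite /riem_length set_itv1 integral_set1.
  move=> eps e0; exists [::], 0; split=> //=; rewrite ?mul0r ?addr0 //.
  by rewrite normr0.
move: pa => /= /andP[ax px].
have ip : itv_partition x b s by split.
have xb := itv_partition_le ip.
have sub1 : {subset `]a, x[ <= `]a, b[}.
  by apply: subset_itvl; rewrite bnd_simp.
have sub2 : {subset `]x, b[ <= `]a, b[}.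
  by apply: subset_itvr; rewrite bnd_simp ltW.
have sg1 : smooth_on a x g by exact: (hs 0%N).
have hg1 z : z \in `]a, x[ -> derivable g z 1 -> horizontal (g z) (derive1 g z).
  by move=> /sub1; exact: hg.
have sg2 i : (i < size s)%N -> smooth_on (nth b (x :: s) i) (nth b s i) g.
  exact: (hs i.+1).
have hg2 : horizontal_curve x b g by move=> z /sub2; exact: hg.
have [l1 [L1 H1]] := piece_poly ax sg1 hg1.
have [k [l2 [L2 H2]]] := ih x ip sg2 hg2.
have m1 := piece_measurable sg1 hg1.
have m2 : measurable_fun `[x, b] (speed g).
  by apply: curve_measurable => //; exists s.
have [_ L] := integral_itv_split (ltW ax) xb m1 m2 (@speed_ge0 _ _ g).
exists k.+1, (l1 + l2); split.
  by rewrite EFinD -L1 -L2; exact: L.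
move=> eps e0.
have [vs1 [t1 [s1 e1 f1 b1]]] := H1 _ e0.
have [vs2 [t2 [s2 e2 f2 b2]]] := H2 _ e0.
exists (vs1 ++ vs2), (t2 + t1); split.
- by rewrite size_cat natrD mulrDl -natr1 mulrDl mul1r; move: s1 s2; lra.
- by move=> v; rewrite mem_cat => /orP[/e1|/e2].
- by rewrite foldl_cat f1 foldl_step_vert f2 -addrA vertD.
- by rewrite size_cat natrD mulrDl addrC (le_trans (ler_normD _ _)) // lerD.
Qed.

(** Steps of equal size bound play the role of a parametrization of constant speed.
    The vertical error is at most rho ^ 2 / M; since M may be any large number, two
    curves can be followed with the same number of steps. *)
Lemma cc_dist_discretize p q rho eta : (cc_dist p q < rho%:E)%E -> 0 < eta ->
  exists M0 : nat, forall M, (M0 <= M)%N -> exists vs tau,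
    [/\ size vs = M, {in vs, forall v, en v <= rho / M%:R},
        foldl step p vs = q + vert tau & `|tau| <= eta].
Proof.
move=> /ereal_inf_lt[_ [a [b [g [ab pg hg [<- <-] ->]]]]] lr eta0.
have [k [l [L H]]] := curve_poly pg hg.
move: lr; rewrite L lte_fin => lr.
have l0 : 0 <= l.
  rewrite -lee_fin -L; apply: integral_ge0 => s _.
  rewrite lee_fin; exact: sqrtr_ge0.
have r0 : 0 < rho := le_lt_trans l0 lr.
have d0 : 0 < rho - l by rewrite subr_gt0.
(* M is large enough for k further steps to fit into the surplus rho - l, and for
   the vertical error rho ^ 2 / M to be at most eta. *)
pose B := k%:R * rho / (rho - l) + rho ^+ 2 / eta + 1.
exists (Num.truncn B).+1 => M M0.
have BM : B <= M%:R.
  by rewrite (le_trans (ltW (Num.Theory.truncnS_gt B))) // ler_nat.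
have B1 : 0 <= k%:R * rho / (rho - l).
  by rewrite divr_ge0 ?mulr_ge0 // ltW.
have B2 : 0 <= rho ^+ 2 / eta by rewrite divr_ge0 ?sqr_ge0 // ltW.
have Mp : 0 < M%:R :> R by move: BM; rewrite /B; lra.
have e0 : 0 < rho / M%:R by rewrite divr_gt0.
have [vs [tau [s1 e1 f1 b1]]] := H _ e0.
have kM : k%:R * rho <= (rho - l) * M%:R.
  by rewrite (mulrC (rho - l)) -ler_pdivrMr //; move: BM B2; rewrite /B; lra.
have sM : (size vs <= M)%N.
  rewrite -(@ler_nat R) -(ler_pM2r e0) (le_trans s1) //.
  rewrite [leRHS]mulrC divfK ?gt_eqF // -lerBrDl mulrA ler_pdivrMr //.
exists (vs ++ nseq (M - size vs) 0), tau; split.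
- by rewrite size_cat size_nseq subnKC.
- move=> v; rewrite mem_cat => /orP[/e1 //|/nseqP[-> _]].
  by rewrite en0 ltW.
- by rewrite foldl_cat f1 foldl_step_nseq0.
- rewrite (le_trans b1) // (@le_trans _ _ (M%:R * (rho / M%:R) ^+ 2)) //.
    by rewrite ler_wpM2r ?sqr_ge0 // ler_nat.
  have -> : M%:R * (rho / M%:R) ^+ 2 = rho ^+ 2 / M%:R :> R.
    by field; rewrite gt_eqF.
  rewrite ler_pdivrMr // mulrC -ler_pdivrMr //.
  by move: BM; rewrite /B; lra.
Qed.

End Discretization.

(** * Functions with a Lipschitz differential, and an implicit function theorem *)

Section ScalarFunctions.
Context {R : realType} {V : normedModType R}.
Implicit Types (f : V -> R) (z e u v : V) (s a c : R).

Lemma is_derive_line f z v s : differentiable f (z + s *: v) ->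
  is_derive s 1 (fun s => f (z + s *: v)) ('d f (z + s *: v) v).
Proof.
move=> df; pose l s := z + s *: v.
have lE : l = (fun s => z + (s - 0) *: v).
  by apply/funext => r; rewrite subr0.
have [dl el] : is_derive s 1 l v by rewrite lE; exact: is_derive_affine.
have dl1 : differentiable l s by apply/derivable1_diffP.
have dd : derivable (f \o l) s 1.
  by apply/derivable1_diffP; exact: differentiable_comp.
apply: (DeriveDef dd); rewrite -derive1E derive1E'; last exact/derivable1_diffP.
by rewrite diff_comp //= -derive1E' // derive1E el.
Qed.

Lemma ball_convex q0 z z' s (R0 : R) :
  `|z - q0| < R0 -> `|z' - q0| < R0 -> 0 <= s <= 1 ->
  `|z + s *: (z' - z) - q0| < R0.
Proof.
move=> Wz Wz' /andP[s0 s1].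
have -> : z + s *: (z' - z) - q0 = (1 - s) *: (z - q0) + s *: (z' - q0).
  have -> : z' - z = (z' - q0) - (z - q0) by rewrite opprB addrA subrK.
  rewrite addrAC; move: (z - q0) (z' - q0) => u v.
  by rewrite scalerBr scalerBl scale1r addrA [in RHS]addrAC.
rewrite (le_lt_trans (ler_normD _ _)) // !normrZ ger0_norm ?subr_ge0 //.
rewrite ger0_norm //.
move: `|z - q0| `|z' - q0| Wz Wz' => x y xR yR.
have [h|h] := leP x y.
  have : (1 - s) * x <= (1 - s) * y by rewrite ler_wpM2l // subr_ge0.
  by lra.
have : s * y <= s * x by rewrite ler_wpM2l // ltW.
by lra.
Qed.


Lemma growth_on_line f z e c (x y : R) : x <= y ->
  (forall s, s \in `[x, y] -> differentiable f (z + s *: e) /\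
     c <= 'd f (z + s *: e) e) ->
  c * (y - x) <= f (z + y *: e) - f (z + x *: e).
Proof.
move=> xy H; pose phi s := f (z + s *: e) - c * s.
have D s (sI : s \in `[x, y]) : is_derive s 1 phi ('d f (z + s *: e) e - c * 1).
  have [df _] := H s sI.
  have Dc : is_derive s 1 (fun x => c * x) (c * 1) by exact: is_derive_mull.
  exact: is_deriveB (is_derive_line df) Dc.
have : phi x <= phi y.
  apply: (derive_ge0_le xy D) => s sI.
  by have [_] := H s (subset_itv_oo_cc sI); rewrite mulr1 subr_ge0.
by rewrite /phi mulrBr; lra.
Qed.

(** By the intermediate value theorem, as f gains at least c * a over the segment on
    one side of z and loses as much on the other. *)
Lemma zero_on_line f z e c a : 0 <= a -> `|f z| <= c * a ->
  (forall s, `|s| <= a -> differentiable f (z + s *: e) /\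
     c <= 'd f (z + s *: e) e) ->
  exists s, `|s| <= a /\ f (z + s *: e) = 0.
Proof.
move=> a0 fz H.
have Na : - a <= 0 by rewrite oppr_le0.
have H' x y s : - a <= x -> y <= a -> s \in `[x, y] ->
    differentiable f (z + s *: e) /\ c <= 'd f (z + s *: e) e.
  rewrite in_itv /= => ax ya /andP[xs sy]; apply: H.
  by rewrite ler_norml (le_trans ax) // (le_trans sy).
have p1 := growth_on_line a0 (fun s => H' 0 a s Na (lexx a)).
have p2 := growth_on_line Na (fun s => H' (- a) 0 s (lexx _) a0).
rewrite scale0r addr0 in p1 p2.
have C : {within `[- a, a], continuous (fun s => f (z + s *: e))}.
  apply: derivable_within_continuous => x xI.
  have [df _] := H' _ _ _ (lexx _) (lexx _) xI.
  by have [] := is_derive_line df.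
move: fz; rewrite ler_norml => /andP[f1 f2].
have aa : - a <= a by apply: le_trans a0.
have [|s sI fs] := IVT (v := 0) aa C.
  rewrite ge_min le_max; apply/andP; split; apply/orP; [left|right].
    by move: p2 f2; rewrite sub0r opprK; lra.
  by move: p1 f1; rewrite subr0; lra.
by exists s; split=> //; rewrite ler_norml; move: sI; rewrite in_itv.
Qed.

End ScalarFunctions.

Section ImplicitCurve.
Context {R : realType} {V : normedModType R} (f : V -> R) (q e v : V) (d L c : R).
Implicit Types (z u : V) (s r y : R).
Let W := [set z : V | `|z - q| < d].
Context (d0 : 0 < d) (L0 : 0 <= L) (c0 : 0 < c)
  (dfW : forall z, W z -> differentiable f z)
  (lipW : forall z z' u, W z -> W z' ->
     `|'d f z u - 'd f z' u| <= L * `|z - z'| * `|u|)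
  (trW : forall z, W z -> c <= 'd f z e)
  (fq : f q = 0) (dfv : 'd f q v = 0).

(** Along a direction killed by the differential at z the differential stays of the
    order of the displacement, so that f changes to second order only. *)
Lemma tangent_increment z u : W z -> W (z + u) -> 'd f z u = 0 ->
  `|f (z + u) - f z| <= L * `|u| ^+ 2.
Proof.
move=> Wz Wzu du.
have Wl s : s \in `[0, 1] -> W (z + s *: u).
  rewrite in_itv => sI; have := ball_convex Wz Wzu sI.
  by rewrite [z + u]addrC addrK.
have D1 s (sI : s \in `[0, 1]) :
    is_derive s 1 (fun s => f (z + s *: u)) ('d f (z + s *: u) u).
  by apply: is_derive_line; apply: dfW; exact: Wl.
have D2 s (sI : s \in `[(0:R), 1]) :
    is_derive s 1 (fun s => L * `|u| ^+ 2 * s) (L * `|u| ^+ 2 * 1).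
  exact: is_derive_mull.
have B s (sI : s \in `]0, 1[) : `|'d f (z + s *: u) u| <= L * `|u| ^+ 2 * 1.
  have sI' := subset_itv_oo_cc sI.
  have := lipW u (Wl s sI') Wz; rewrite du subr0 => /le_trans; apply.
  rewrite [z + _]addrC addrK normrZ mulr1 expr2 !mulrA ler_wpM2r //.
  rewrite ler_wpM2r // ler_piMr //.
  by move: sI'; rewrite in_itv /= ler_norml => /andP[s0 ->]; rewrite (le_trans _ s0).
have := increment_le ler01 D1 D2 B.
by rewrite scale1r scale0r addr0 mulr1 mulr0 subr0.
Qed.

(** This makes the zeros of f along e unique and stable. *)
Lemma transverse_lower z y : W z -> W (z + y *: e) ->
  c * `|y| <= `|f (z + y *: e) - f z|.
Proof.
move=> Wz Wy.
have Wl s : s \in `[0, 1] -> W (z + s *: (y *: e)).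
  rewrite in_itv => sI; have := ball_convex Wz Wy sI.
  by rewrite [z + y *: e]addrC addrK.
have Wr r : 0 <= r -> r <= 1 -> W (z + (r * y) *: e).
  by move=> r0 r1; rewrite -scalerA; apply: Wl; rewrite in_itv /= r0.
have [y0|y0] := leP 0 y.
  rewrite (ger0_norm y0).
  have := @growth_on_line _ _ f z e c 0 y y0.
  rewrite subr0 scale0r addr0 => /(_ _)/le_trans-> //; last exact: ler_norm.
  move=> s; rewrite in_itv /= => /andP[s0 sy].
  have [ye|yn] := eqVneq y 0.
    have -> : s = 0 by apply/eqP; rewrite eq_le s0 -ye sy.
    by rewrite scale0r addr0; split; [exact: dfW|exact: trW].
  have yp : 0 < y by rewrite lt0r yn.
  have : W (z + s *: e).
    have := @Wr (s / y); rewrite divfK //; apply; first by rewrite divr_ge0.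
    by rewrite ler_pdivrMr ?mul1r.
  by move=> Ws; split; [exact: dfW|exact: trW].
rewrite (ltr0_norm y0).
have := @growth_on_line _ _ f z e c y 0 (ltW y0).
rewrite sub0r scale0r addr0 => /(_ _)/le_trans-> //.
  move=> s; rewrite in_itv /= => /andP[ys s0].
  have : W (z + s *: e).
    have := @Wr (s / y); rewrite divfK ?lt_eqF //; apply.
      by rewrite -mulrNN -invrN divr_ge0 // oppr_ge0 // ltW.
    by rewrite ler_ndivrMr ?mul1r.
  by move=> Ws; split; [exact: dfW|exact: trW].
by rewrite distrC ler_norm.
Qed.


Lemma chord_split (p u w : V) (s t h k h' : R) :
  p + (t + s) *: u + h' *: w =
  p + s *: u + h *: w + t *: (u + k *: w) + (h' - h - t * k) *: w.
Proof.
rewrite scalerDr scalerA !scalerBl scalerDl !addrA.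
move: (t *: u) (s *: u) (h *: w) ((t * k) *: w) (h' *: w) => A B H T H'.
rewrite (addrAC _ (- H) (- T)) (addrAC _ H' (- T)) addrK.
by rewrite (addrAC _ H' (- H)) (addrAC _ A (- H)) addrK (addrAC p B A).
Qed.

Lemma chord_quotient (p u w : V) (t y : R) : t != 0 ->
  u - t^-1 *: (p + t *: u + y *: w - p) = - (t^-1 * y) *: w.
Proof.
move=> t0; rewrite -[p + _ + _]addrA [p + _]addrC addrK scalerDr !scalerA.
by rewrite mulVf // scale1r opprD addrA subrr add0r scaleNr.
Qed.

(** The implicit function theorem in one unknown: g s = q + s v + h s e, where h s
    solves f (g s) = 0. At any s the slope of h is k = - df v / df e. Indeed
    v + k e is in the kernel of the differential at g s, so that
    f (g s + t (v + k e)) is of order t ^ 2; as f grows along e at the rate c, the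
    difference between h (s + t) and h s + k t is of order t ^ 2 as well. The
    Lipschitz bound on the differential makes k continuous. *)
Lemma implicit_curve : exists g : R -> V, [/\ g 0 = q, derive1 g 0 = v &
  \forall s \near (0 : R), [/\ W (g s) /\ f (g s) = 0, derivable g s 1 &
    {for s, continuous (derive1 g)}]].
Proof.
(* a bounds the correction along e, and r the parameter, so that all the points
   stay within d / 2 of q and zero_on_line applies. *)
pose a := d / (4 * (`|e| + 1)).
have e1 : 0 < `|e| + 1 by rewrite ltr_wpDl.
have a0 : 0 < a by rewrite divr_gt0 // mulr_gt0.
have ae y : `|y| <= a -> `|y *: e| <= d / 4.
  move=> ya; rewrite normrZ.
  apply: (@le_trans _ _ (a * (`|e| + 1))); first by rewrite ler_pM // lerDl.
  by rewrite le_eqVlt; apply/orP; left; apply/eqP; rewrite /a; field; rewrite gt_eqF.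
have v1 : 0 < `|v| + 1 by rewrite ltr_wpDl.
pose K := L * `|v| ^+ 2.
have K0 : 0 <= K by rewrite mulr_ge0 // sqr_ge0.
pose r := Num.min (d / (4 * (`|v| + 1))) (Num.min 1 (c * a / (K + 1))).
have r0 : 0 < r.
  by rewrite !lt_min ltr01 !divr_gt0 // ?mulr_gt0 // ltr_wpDl.
have r1 : r <= 1 by rewrite !ge_min lexx orbT.
have rv s : `|s| <= r -> `|s *: v| <= d / 4.
  move=> sr; rewrite normrZ.
  have rr : r <= d / (4 * (`|v| + 1)) by rewrite ge_min lexx.
  apply: (@le_trans _ _ (d / (4 * (`|v| + 1)) * (`|v| + 1))).
    by rewrite ler_pM ?lerDl // (le_trans sr).
  by rewrite le_eqVlt; apply/orP; left; apply/eqP; field; rewrite gt_eqF.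
have inW z : `|z - q| <= d / 2 -> W z.
  by move=> h; rewrite /W /= (le_lt_trans h) // ltr_pdivrMr // ltr_pMr // ltr1n.
have two s y : `|s| <= r -> `|y| <= a -> `|q + s *: v + y *: e - q| <= d / 2.
  move=> sr ya; rewrite -[q + _ + _]addrA [q + _]addrC addrK.
  apply: (le_trans (ler_normD _ _)).
  apply: (le_trans (lerD (rv _ sr) (ae _ ya))).
  by rewrite le_eqVlt; apply/orP; left; apply/eqP; field.
have near_q s : `|s| <= r -> `|q + s *: v - q| <= d / 2.
  by move=> sr; have := two s 0 sr; rewrite scale0r addr0 normr0; apply; exact: ltW.
have Wq : W q by rewrite /W /= subrr normr0.
have [h hP] : {h : R -> R & forall s, `|s| <= r ->
    `|h s| <= a /\ f (q + s *: v + h s *: e) = 0}.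
  apply: (@choice _ _ (fun s y => `|s| <= r ->
    `|y| <= a /\ f (q + s *: v + y *: e) = 0)) => s.
  have [sr|sr] := leP `|s| r; last by exists 0.
  have small : `|f (q + s *: v)| <= c * a.
    have := tangent_increment Wq (inW _ (near_q _ sr)).
    rewrite linearZ /= dfv scaler0 fq subr0 => /(_ erefl)/le_trans; apply.
    rewrite normrZ exprMn mulrCA -/K mulrC.
    have s2 : `|s| ^+ 2 <= r.
      rewrite expr2 (le_trans _ sr) // ler_piMl // (le_trans sr) //.
    apply: (@le_trans _ _ ((K + 1) * r)).
      by rewrite ler_pM // ?sqr_ge0 // lerDl.
    rewrite mulrC -ler_pdivlMr ?ltr_wpDl //.
    by rewrite !ge_min lexx !orbT.
  have [|y [ya fy]] := zero_on_line (e := e) (ltW a0) small.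
    by move=> y ya; have Wy := inW _ (two _ _ sr ya); split; [exact: dfW|exact: trW].
  by exists y.
pose g s := q + s *: v + h s *: e.
have Wg s : `|s| <= r -> W (g s).
  by move=> sr; have [ha _] := hP s sr; apply: inW; exact: two.
have gq s : `|s| <= r -> `|g s - q| <= d / 2.
  by move=> sr; have [ha _] := hP s sr; exact: two.
have fg s : `|s| <= r -> f (g s) = 0 by move=> /hP[].
pose k s := - 'd f (g s) v / 'd f (g s) e.
have de s : `|s| <= r -> 0 < 'd f (g s) e.
  by move=> sr; apply: (lt_le_trans c0); apply: trW; exact: Wg.
have h0 : h 0 = 0.
  have r00 : `|0 : R| <= r by rewrite normr0 ltW.
  have := @transverse_lower q (h 0) Wq.
  have E : q + h 0 *: e = g 0 by rewrite /g scale0r addr0.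
  rewrite E fq (fg 0 r00) subrr normr0 => /(_ (Wg 0 r00)).
  by rewrite pmulr_rle0 // normr_le0 => /eqP.
have g0 : g 0 = q by rewrite /g h0 !scale0r !addr0.
have dg s : `|s| < r -> is_derive s 1 g (v + k s *: e).
  move=> sr; have sr' := ltW sr.
  set u := v + k s *: e.
  have du : 'd f (g s) u = 0.
    rewrite /u linearD linearZ /= /k /GRing.scale /= divfK ?subrr //.
    by rewrite gt_eqF // de.
  apply/is_derive1P; apply/cvgrPdist_le => /= eps eps0.
  pose C := L * `|u| ^+ 2 / c * `|e|.
  have Lu : 0 <= L * `|u| ^+ 2 by rewrite mulr_ge0 // sqr_ge0.
  have C0 : 0 <= C by rewrite mulr_ge0 // divr_ge0 // ltW.
  have C1 : 0 < C + 1 by rewrite ltr_wpDl.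
  have u1 : 0 < `|u| + 1 by rewrite ltr_wpDl.
  near=> t.
  have t0 : t != 0 by near: t; exact: nbhs_dnbhs_neq.
  have tsr : `|t + s| <= r.
    rewrite (le_trans (ler_normD _ _)) // -lerBrDr.
    near: t; apply: dnbhs0_le; rewrite subr_gt0 //.
  have tu : `|t *: u| < d / 2.
    rewrite normrZ; apply: (@le_lt_trans _ _ (`|t| * (`|u| + 1))).
      by rewrite ler_wpM2l // lerDl.
    rewrite -ltr_pdivlMr //; near: t; apply: dnbhs0_lt.
    by rewrite !divr_gt0.
  have tC : `|t| <= eps / (C + 1).
    by near: t; apply: dnbhs0_le; rewrite divr_gt0.
  have Wu : W (g s + t *: u).
    rewrite /W /= addrAC (le_lt_trans (ler_normD _ _)) //.
    by have := ler_ltD (gq s sr') tu; rewrite -splitr.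
  (* y is the error of the linear prediction for h. *)
  pose y := h (t + s) - h s - t * k s.
  have gE : g (t + s) = g s + t *: u + y *: e.
    by rewrite /g /u /y; exact: chord_split.
  have Wgts := Wg _ tsr.
  rewrite gE in Wgts.
  have lower := transverse_lower Wu Wgts.
  rewrite -gE fg // sub0r normrN in lower.
  have := tangent_increment (Wg _ sr') Wu.
  rewrite linearZ /= du scaler0 fg // subr0 normrZ exprMn => /(_ erefl) upper.
  have ylt : `|y| <= L * (`|t| ^+ 2 * `|u| ^+ 2) / c.
    by rewrite ler_pdivlMr // mulrC (le_trans lower).
  have -> : u - t^-1 *: (g (t + s) - g s) = - (t^-1 * y) *: e.
    by rewrite gE; exact: chord_quotient.
  rewrite normrZ normrN normrM normfV.
  apply: (@le_trans _ _ (`|t| * C)).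
    have -> : `|t| * C = `|t|^-1 * (L * (`|t| ^+ 2 * `|u| ^+ 2) / c) * `|e|.
      by rewrite /C; field; rewrite normr_eq0 t0 gt_eqF.
    by rewrite ler_wpM2r // ler_wpM2l // invr_ge0.
  rewrite (le_trans (ler_wpM2r C0 tC)) // mulrAC ler_pdivrMr //.
  by rewrite ler_wpM2l ?ltW // ltrDl.
have cg s : `|s| < r -> {for s, continuous g}.
  by move=> sr; apply: derivable1_continuous; have [] := dg s sr.
have d1 s : `|s| < r -> derive1 g s = v + k s *: e.
  by move=> sr; rewrite derive1E; have [_ ->] := dg s sr.
have r00 : `|0 : R| < r by rewrite normr0.
have near_r s : `|s| < r -> \forall x \near s, `|x| < r.
  move=> sr; have /cvgr_lt := @norm_continuous _ R s; exact.
exists g; split=> //.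
  by rewrite d1 // /k g0 dfv oppr0 mul0r scale0r addr0.
have : \forall s \near (0 : R), `|s| < r by exact: near_r.
apply: filterS => s sr; split.
- by split; [exact: Wg (ltW sr)|exact: fg (ltW sr)].
- by have [] := dg s sr.
have cdf w : 'd f (g x) w @[x --> s] --> 'd f (g s) w.
  apply/cvgrPdist_le => /= eps eps0.
  have w1 : 0 < L * `|w| + 1 by rewrite ltr_wpDl // mulr_ge0.
  near=> x.
  have xr : `|x| < r by near: x; exact: near_r.
  apply: (le_trans (lipW w (Wg _ (ltW sr)) (Wg _ (ltW xr)))).
  rewrite mulrAC; apply: (@le_trans _ _ ((L * `|w| + 1) * `|g s - g x|)).
    by rewrite ler_wpM2r // lerDl.
  rewrite mulrC -ler_pdivlMr //; near: x.
  by apply: cvgr_dist_le; [exact: cg|rewrite divr_gt0].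
have ck : v + k x *: e @[x --> s] --> v + k s *: e.
  apply: cvgD; first exact: cvg_cst.
  apply: cvgZr_tmp; apply: cvgM; first exact: cvgN.
  by apply: cvgV; [rewrite gt_eqF // de // ltW|exact: cdf].
rewrite /prop_for /continuous_at (d1 s sr).
apply: cvg_trans ck; apply: near_eq_cvg.
by apply: filterS (near_r s sr) => x xr; rewrite d1.
Unshelve. all: by end_near. Qed.

End ImplicitCurve.

(** * The distance in terms of polygons *)

Section PolygonDistance.
Context {R : realType} {n : nat}.
Implicit Types (p q : heis R n) (v : hplane R n) (vs : seq (hplane R n)).
Implicit Types (eps tau rho : R).

Lemma plen_le vs eps : {in vs, forall v, en v <= eps} ->
  plen vs <= (size vs)%:R * eps.
Proof.
move=> le; rewrite mulr_natl -sum1_size -sumrMnr /plen.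
rewrite big_seq [leRHS]big_seq; apply: ler_sum => v vI; rewrite mulr1n; exact: le.
Qed.

Lemma step_opp p v : step (step p v) (- v) = p.
Proof.
rewrite !stepE /= !omD oppr0 addr0 addrK -addrA subrr addr0.
by rewrite -surjective_pairing.
Qed.

Lemma foldl_step_rev p q vs : foldl step p vs = q ->
  foldl step q (rev (map -%R vs)) = p.
Proof.
elim/last_ind: vs q => [|vs v ih] q /=; first by move=> ->.
by rewrite foldl_rcons map_rcons rev_rcons /= => <-; rewrite step_opp ih.
Qed.

Lemma plen_rev vs : plen (rev (map -%R vs)) = plen vs.
Proof.
rewrite /plen (perm_big (map -%R vs)) ?perm_rev //= big_map.
by apply: eq_bigr => v _; rewrite enN.
Qed.

Lemma en_foldl_step p vs : en ((foldl step p vs).1 - p.1) <= plen vs.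
Proof.
elim/last_ind: vs => [|vs v ih]; first by rewrite subrr en0 plen_ge0.
rewrite foldl_rcons plen_rcons stepE /= addrAC (le_trans (enD _ _)) //.
by rewrite lerD2r.
Qed.

Lemma heis_norm_le p (B : R) : en p.1 <= B -> `|p.2| <= B -> `|p| <= B.
Proof.
move=> h1 h2; rewrite prod_normE ge_max h2 andbT.
exact: le_trans (norm_le_en _) h1.
Qed.

Lemma hv_norm_le p v : `|hv p v| <= en v * (1 + en p.1).
Proof.
have e0 := en_ge0 v; have c0 := en_ge0 p.1.
apply: heis_norm_le => /=; first by rewrite ler_peMr // lerDl.
rewrite (le_trans (om_le _ _)) // mulrC ler_wpM2l //.
by rewrite lerDr.
Qed.

Lemma foldl_step_norm p vs :
  `|foldl step p vs - p| <= plen vs * (1 + en p.1 + plen vs).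
Proof.
have p0 := en_ge0 p.1.
elim/last_ind: vs => [|vs v ih].
  by rewrite subrr normr0 /plen big_nil mul0r.
have l0 := plen_ge0 vs; have v0 := en_ge0 v.
rewrite foldl_rcons plen_rcons /step addrAC (le_trans (ler_normD _ _)) //.
have /(le_trans (hv_norm_le _ _)) h : en v * (1 + en (foldl step p vs).1) <=
    en v * (1 + en p.1 + plen vs).
  have := enD ((foldl step p vs).1 - p.1) p.1; rewrite subrK => h.
  by rewrite ler_wpM2l //; have := en_foldl_step p vs; lra.
apply: le_trans (lerD ih h) _.
rewrite -mulrDl ler_wpM2l ?addr_ge0 // addrA lerDl //.
Qed.

(** The length of a horizontal segment from q to the vertical line of p, followed by
    a loop that changes t alone. It is continuous in p and vanishes at p = q, and
    so carries the Euclidean topology over to the distance. *)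
Definition conn q p : R :=
  en (p.1 - q.1) + 3 * Num.sqrt `|p.2 - q.2 - om q.1 (p.1 - q.1)|.

Context (n_ge1 : (1 <= n)%N).

Let i0 : 'I_n := Ordinal n_ge1.
Let e1 : hplane R n := (delta_mx ord0 i0, 0).
Let e2 : hplane R n := (0, delta_mx ord0 i0).

Let en_e1 : en e1 = 1.
Proof.
rewrite /en (_ : dot e1 e1 = 1) ?sqrtr1 // /dot (bigD1 i0) //=.
rewrite !mxE !eqxx /= !mulr1 mul0r addr0 big1 ?addr0 // => i /negPf ni.
by rewrite !mxE ni !andbF !mul0r addr0.
Qed.

Let en_e2 : en e2 = 1.
Proof.
rewrite /en (_ : dot e2 e2 = 1) ?sqrtr1 // /dot (bigD1 i0) //=.
rewrite !mxE !eqxx /= !mulr1 mul0r add0r big1 ?addr0 // => i /negPf ni.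
by rewrite !mxE ni !andbF !mul0r addr0.
Qed.

Let om_e12 : om e1 e2 = - 1.
Proof.
rewrite /om (bigD1 i0) //= !mxE !eqxx /= !mulr1 mul0r sub0r big1 ?addr0 //.
by move=> i /negPf ni; rewrite !mxE ni !andbF !mul0r subrr.
Qed.

(** A rectangle with sides a and b along two horizontal fields X_i, Y_i is the
    commutator of two translations, which moves t by - 2 a b. *)
Lemma vert_poly p tau : exists vs,
  foldl step p vs = p + vert tau /\ plen vs <= 3 * Num.sqrt `|tau|.
Proof.
(* The sides are chosen with - 2 a b = tau and of the order of the root of tau. *)
pose a := Num.sqrt `|tau|; pose b := - (Num.sg tau * a / 2).
have a0 : 0 <= a by exact: sqrtr_ge0.
have ab : - (2 * a * b) = tau.
  rewrite /b; have -> : - (2 * a * - (Num.sg tau * a / 2)) = Num.sg tau * a ^+ 2.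
    by field.
  by rewrite sqr_sqrtr ?normr_ge0 // -numEsg.
exists [:: a *: e1; b *: e2; - (a *: e1); - (b *: e2)]; split.
  rewrite /= !stepE; congr pair => /=.
    by rewrite addr0 [_ + _ *: e2 - a *: e1]addrAC !addrK.
  rewrite !omD (omC e2 e1) om_e12 -ab; ring.
rewrite /plen !big_cons big_nil !enN !enZ en_e1 en_e2 !mulr1 addr0.
have b_le : `|b| <= a / 2.
  rewrite /b normrN -mulrA normrM normr_sg [`|a / 2|]ger0_norm ?divr_ge0 //.
  by case: (tau != 0); rewrite ?mul1r // mul0r divr_ge0.
by rewrite -/a ger0_norm //; lra.
Qed.

Lemma conn_poly q p : exists vs, foldl step q vs = p /\ plen vs <= conn q p.
Proof.
have [vs [E L]] := vert_poly (step q (p.1 - q.1))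
  (p.2 - q.2 - om q.1 (p.1 - q.1)).
exists ((p.1 - q.1) :: vs); split.
  rewrite /= E stepE [RHS]surjective_pairing; congr pair => /=.
    by rewrite addr0 addrC subrK.
  by ring.
by rewrite /plen big_cons lerD2l.
Qed.

(** The vertical error of a discretized curve is repaired by vert_poly, at a cost
    that tends to 0 with the error. From here on polygons replace curves. *)
Lemma cc_dist_lt p q rho : (cc_dist p q < rho%:E)%E <->
  exists vs, foldl step p vs = q /\ plen vs < rho.
Proof.
split=> [|[vs [<- lt]]]; last by rewrite (le_lt_trans (cc_dist_poly _ _)) ?lte_fin.
move=> /ereal_inf_lt[_ [a [b [g [ab pg hg [ga gb] ->]]]]] lr.
have [k [l [L _]]] := curve_poly pg hg.
move: lr; rewrite -/(riem_length a b g) L lte_fin => lr.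
(* Half of the surplus rho - l absorbs the discretization, the other half the
   vertical correction. *)
pose rho' := (l + rho) / 2.
have dl : (cc_dist p q <= l%:E)%E.
  by apply: ereal_inf_lbound; exists a, b, g; split=> //; rewrite L.
have dr : (cc_dist p q < rho'%:E)%E.
  by rewrite (le_lt_trans dl) // lte_fin /rho'; lra.
have rr : rho' < rho by rewrite /rho'; lra.
have eta0 : 0 < ((rho - rho') / 6) ^+ 2.
  by rewrite exprn_gt0 // divr_gt0 ?subr_gt0.
have [M0 /(_ M0.+1 (leqnSn _))[vs [tau [sz le ends tle]]]] :=
  cc_dist_discretize dr eta0.
have [ws [E W]] := vert_poly (q + vert tau) (- tau).
exists (vs ++ ws); rewrite foldl_cat ends E -addrA vertD subrr vert0 addr0.
split=> //; rewrite plen_cat.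
have Lv := plen_le le; rewrite sz mulrC divfK ?pnatr_eq0 // in Lv.
have : Num.sqrt `|- tau| <= (rho - rho') / 6.
  rewrite normrN -[leRHS]ger0_norm; last by rewrite divr_ge0 // subr_ge0 ltW.
  by rewrite -[leRHS]sqrtr_sqr ler_wsqrtr.
by move: W; lra.
Qed.

Lemma cc_dist_ge0 p q : (0 <= cc_dist p q)%E.
Proof.
apply/ereal_infP => _ [a [b [g [_ _ _ _ ->]]]].
by apply: integral_ge0 => s _; rewrite lee_fin sqrtr_ge0.
Qed.

Lemma cc_dist_fin p q : cc_dist p q \is a fin_num.
Proof.
have [vs [<- _]] := conn_poly p q.
by rewrite ge0_fin_numE ?cc_dist_ge0 // (le_lt_trans (cc_dist_poly _ _)) ?ltry.
Qed.

(** A polygon is run backwards by the opposite steps. *)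
Lemma cc_dist_sym_lt p q rho : (cc_dist p q < rho%:E)%E -> (cc_dist q p < rho%:E)%E.
Proof.
move=> /cc_dist_lt[vs [E L]]; apply/cc_dist_lt.
by exists (rev (map -%R vs)); rewrite plen_rev (foldl_step_rev E).
Qed.

Lemma cc_dist_triangle_conn p q q' :
  (cc_dist p q' <= cc_dist p q + (conn q q')%:E)%E.
Proof.
apply/lee_addgt0Pr => e e0.
have /cc_dist_lt[vs [E L]] : (cc_dist p q < (fine (cc_dist p q) + e)%:E)%E.
  by rewrite -{1}(fineK (cc_dist_fin p q)) lte_fin ltrDl.
have [ws [E' L']] := conn_poly q q'.
have := cc_dist_poly p (vs ++ ws); rewrite foldl_cat E E' plen_cat => le.
rewrite (le_trans le) // -(fineK (cc_dist_fin p q)) -!EFinD lee_fin; lra.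
Qed.

End PolygonDistance.

(** * Existence of a nearest point *)

Section NearestPoints.
Context {R : realType} {n : nat}.
Implicit Types (p q z : heis R n) (S : set (heis R n)).

Lemma conn_sym q p : conn q p = conn p q.
Proof.
rewrite /conn -enN opprB -[in RHS]normrN; congr (_ + 3 * Num.sqrt `|_|).
have -> : om p.1 (q.1 - p.1) = - om q.1 (p.1 - q.1).
  by rewrite !omD (omC q.1 p.1); ring.
ring.
Qed.

Lemma conn_near q (e : R) : 0 < e -> \forall z \near q, conn q z <= e.
Proof.
move=> e0.
pose m : R := n.*2%:R; have m0 : 0 <= m by [].
pose K := 1 + en q.1 * m.
have K0 : 0 < K by rewrite ltr_wpDr // mulr_ge0 // en_ge0.
near=> z.
have d1 : `|z - q| <= e / 2 / (m + 1).
  rewrite distrC; near: z; apply: cvgr_dist_le => //.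
  by rewrite !divr_gt0 // ltr_wpDl.
have d2 : `|z - q| <= (e / 6) ^+ 2 / K.
  rewrite distrC; near: z; apply: cvgr_dist_le => //.
  by rewrite divr_gt0 // exprn_gt0 // divr_gt0.
have enz : en (z.1 - q.1) <= m * `|z - q| := en1_le (z - q).
have h1 : en (z.1 - q.1) <= e / 2.
  move: d1; rewrite ler_pdivlMr ?ltr_wpDl // => d1.
  rewrite (le_trans enz) // (le_trans _ d1) // mulrC ler_wpM2l // lerDl //.
have h2 : `|z.2 - q.2 - om q.1 (z.1 - q.1)| <= (e / 6) ^+ 2.
  move: d2; rewrite ler_pdivlMr // => d2.
  rewrite (le_trans (ler_normB _ _)) // (le_trans _ d2) // /K mulrDr mulr1 lerD //.
    exact: (norm2_le (z - q)).
  rewrite (le_trans (om_le _ _)) // mulrCA ler_wpM2l ?en_ge0 // mulrC //.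
have h3 : Num.sqrt `|z.2 - q.2 - om q.1 (z.1 - q.1)| <= e / 6.
  rewrite -[leRHS]ger0_norm; last by rewrite divr_ge0 // ltW.
  by rewrite -[leRHS]sqrtr_sqr ler_wsqrtr.
by rewrite /conn; move: h1 h3; lra.
Unshelve. all: by end_near. Qed.

Context (n_ge1 : (1 <= n)%N).

Lemma cc_dist_continuous p : continuous (fun q => fine (cc_dist p q)).
Proof.
move=> q; apply/cvgrPdist_le => /= e e0.
near=> z.
have cz : conn q z <= e by near: z; exact: conn_near.
have h1 := cc_dist_triangle_conn n_ge1 p q z.
have h2 := cc_dist_triangle_conn n_ge1 p z q.
rewrite -(fineK (cc_dist_fin n_ge1 p q)) -(fineK (cc_dist_fin n_ge1 p z)) in h1.
rewrite -EFinD lee_fin in h1.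
rewrite -(fineK (cc_dist_fin n_ge1 p q)) -(fineK (cc_dist_fin n_ge1 p z)) in h2.
rewrite -EFinD lee_fin conn_sym in h2.
by rewrite ler_norml; apply/andP; split; move: h1 h2 cz; lra.
Unshelve. all: by end_near. Qed.

Lemma norm_le_compact (B : R) : compact [set z : heis R n | `|z| <= B].
Proof.
have cl (V : normedModType R) : closed [set x : V | `|x| <= B].
  apply: (@preimage_closed _ _ (fun x : V => `|x|) [set t | t <= B]).
    by move=> x _; exact: norm_continuous.
  exact: closed_le.
have cV : compact [set x : 'rV[R]_n | `|x| <= B].
  apply: bounded_closed_compact; last exact: cl.
  by exists B; split; [exact: num_real|move=> M BM x /= /le_trans; apply; exact: ltW].
have cR : compact [set x : R | `|x| <= B].
  rewrite (_ : [set x | _] = `[- B, B]%classic); first exact: segment_compact.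
  by apply/seteqP; split=> x /=; rewrite in_itv /= ler_norml.
have := compact_setX (compact_setX cV cV) cR.
congr compact; apply/seteqP; split=> -[[x y] t] /=.
  by move=> [[h1 h2] h3]; rewrite !prod_normE /= !ge_max h1 h2 h3.
by rewrite !prod_normE /= !ge_max => /andP[/andP[]].
Qed.

Lemma cc_dist_norm p q rho : (cc_dist p q < rho%:E)%E ->
  `|q - p| <= rho * (1 + en p.1 + rho).
Proof.
move=> /(cc_dist_lt n_ge1)[vs [<- lt]].
have p0 := en_ge0 p.1; have l0 := plen_ge0 vs.
rewrite (le_trans (foldl_step_norm _ _)) // ler_pM ?addr_ge0 // ?ltW //.
by rewrite ltrD2l.
Qed.

(** The points of S at a distance below D q0 + 1 from p lie in a Euclidean ball, which
    is compact. *)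
Lemma nearest_exists S p q0 : closed S -> S q0 -> exists q, nearest S p q.
Proof.
move=> cS Sq0; pose D q := fine (cc_dist p q).
pose rho := D q0 + 1.
pose A := S `&` [set z | `|z| <= `|p| + rho * (1 + en p.1 + rho)].
have inA q : S q -> D q < rho -> A q.
  move=> Sq Dq; split=> //=.
  have /cc_dist_norm h : (cc_dist p q < rho%:E)%E.
    by rewrite -(fineK (cc_dist_fin n_ge1 p q)) lte_fin.
  by rewrite -[q](subrK p) addrC (le_trans (ler_normD _ _)) // lerD2l.
have cA : compact A by rewrite /A setIC; apply: compact_closedI => //; exact: norm_le_compact.
have Aq0 : A q0 by apply: inA => //; rewrite ltrDl.
have [q qA qmin] : exists2 q, q \in A & forall z, z \in A -> D q <= D z.
  apply: compact_EVT_min => //; first by exists q0.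
  by apply: continuous_subspaceT; exact: cc_dist_continuous.
exists q; split; first by move: qA; rewrite inE => -[].
move=> z Sz; rewrite -(fineK (cc_dist_fin n_ge1 p q)).
rewrite -(fineK (cc_dist_fin n_ge1 p z)) lee_fin.
have [/inA zA|h] := ltP (D z) rho; first by apply: qmin; rewrite inE; exact: zA.
by apply: le_trans h; rewrite (le_trans (qmin q0 _)) ?inE // lerDl.
Qed.

End NearestPoints.

(** * Averages of polygons *)

Section Averages.
Context {R : realType} {n : nat}.
Implicit Types (p : heis R n) (u v : hplane R n).
Implicit Types (zs : seq (hplane R n * hplane R n)).

Definition avg (z : hplane R n * hplane R n) : hplane R n := 2^-1 *: (z.1 + z.2).

(** For polygons with M steps this is the L^1 distance between the velocities of the
    two curves run in unit time. *)
Definition gap zs : R := \sum_(z <- zs) en (z.1 - z.2).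

Lemma gap_rcons zs z : gap (rcons zs z) = gap zs + en (z.1 - z.2).
Proof. by rewrite /gap -cats1 big_cat big_seq1. Qed.

Lemma gap_ge0 zs : 0 <= gap zs.
Proof. by apply: sumr_ge0 => z _; exact: en_ge0. Qed.

Lemma gap_le zs : gap zs <= plen (map fst zs) + plen (map snd zs).
Proof.
by rewrite /plen !big_map -big_split; apply: ler_sum => z _; exact: enB.
Qed.

Lemma avg_endpoint1 p zs : (foldl step p (map avg zs)).1 =
  2^-1 *: ((foldl step p (map fst zs)).1 + (foldl step p (map snd zs)).1).
Proof.
elim/last_ind: zs => [|zs z ih] /=.
  by rewrite -[p.1 + p.1]mulr2n -[p.1 *+ 2]scaler_nat scalerA mulVf ?scale1r // pnatr_eq0.
by rewrite !map_rcons !foldl_rcons !stepE /= ih /avg -scalerDr addrACA.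
Qed.

Lemma gap_endpoint1 p zs :
  en ((foldl step p (map fst zs)).1 - (foldl step p (map snd zs)).1) <= gap zs.
Proof.
elim/last_ind: zs => [|zs z ih]; first by rewrite subrr en0 gap_ge0.
rewrite !map_rcons !foldl_rcons !stepE gap_rcons /= opprD addrACA.
by rewrite (le_trans (enD _ _)) // lerD2r.
Qed.

(** The coordinate t of the end is a quadratic function of the steps. Hence averaging
    commutes with taking the end up to the quadratic part of the difference, a sum
    of terms om (c1 - c2) (v1 - v2) / 4. *)
Lemma avg_endpoint2 p zs :
  `|(foldl step p (map avg zs)).2 -
    ((foldl step p (map fst zs)).2 + (foldl step p (map snd zs)).2) / 2|
  <= gap zs ^+ 2.
Proof.
elim/last_ind: zs => [|zs z ih] /=.
  have -> : p.2 - (p.2 + p.2) / 2 = 0 by field.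
  by rewrite normr0 sqr_ge0.
have h1 := gap_endpoint1 p zs; have c1 := avg_endpoint1 p zs.
have g0 := gap_ge0 zs; have w0 := en_ge0 (z.1 - z.2).
rewrite !map_rcons !foldl_rcons !stepE gap_rcons /= c1.
move: h1 ih; set P1 := foldl _ _ (map fst zs); set P2 := foldl _ _ (map snd zs).
set Pm := foldl _ _ _; set e := en _ in w0 *; set g := gap zs in g0 *.
move=> h1 ih.
have -> : Pm.2 + om (2^-1 *: (P1.1 + P2.1)) (avg z) -
    (P1.2 + om P1.1 z.1 + (P2.2 + om P2.1 z.2)) / 2 =
    Pm.2 - (P1.2 + P2.2) / 2 - om (P1.1 - P2.1) (z.1 - z.2) / 4.
  by rewrite /avg !omD; field.
rewrite (le_trans (ler_normB _ _)) //.
have h2 : `|om (P1.1 - P2.1) (z.1 - z.2) / 4| <= g * e.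
  rewrite normrM [`|4^-1|]ger0_norm //.
  rewrite ler_pdivrMr // (le_trans (om_le _ _)) // (@le_trans _ _ (g * e)) //.
    by rewrite ler_wpM2r.
  by rewrite ler_peMr // ?mulr_ge0 // ler1n.
rewrite (le_trans (lerD ih h2)) // sqrrD -addrA lerD2l mulr2n -addrA lerDl.
by rewrite addr_ge0 ?sqr_ge0 // mulr_ge0.
Qed.

Lemma gap_endpoint2 p zs :
  `|(foldl step p (map fst zs)).2 - (foldl step p (map snd zs)).2| <=
  (en p.1 + plen (map fst zs) + plen (map snd zs)) * gap zs.
Proof.
elim/last_ind: zs => [|zs z ih].
  by rewrite subrr normr0 /gap big_nil mulr0.
have h1 := gap_endpoint1 p zs.
have c1 := en_foldl_step p (map fst zs).
have g0 := gap_ge0 zs; have w0 := en_ge0 (z.1 - z.2).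
have l1 := plen_ge0 (map fst zs); have l2 := plen_ge0 (map snd zs).
have v1 := en_ge0 z.1; have v2 := en_ge0 z.2; have p0 := en_ge0 p.1.
rewrite !map_rcons !foldl_rcons !stepE !plen_rcons gap_rcons /=.
move: h1 c1 ih; set P1 := foldl _ _ (map fst zs).
set P2 := foldl _ _ (map snd zs); move=> h1 c1 ih.
have -> : P1.2 + om P1.1 z.1 - (P2.2 + om P2.1 z.2) =
  P1.2 - P2.2 + om P1.1 (z.1 - z.2) + om (P1.1 - P2.1) z.2.
  by rewrite !omD; ring.
have c2 : en P1.1 <= en p.1 + plen (map fst zs).
  by have := enD (P1.1 - p.1) p.1; rewrite subrK; lra.
have b1 : `|om P1.1 (z.1 - z.2)| <= (en p.1 + plen (map fst zs)) * en (z.1 - z.2).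
  by rewrite (le_trans (om_le _ _)) // ler_wpM2r.
have b2 : `|om (P1.1 - P2.1) z.2| <= gap zs * en z.2.
  by rewrite (le_trans (om_le _ _)) // ler_wpM2r.
rewrite (le_trans (ler_normD _ _)) // (le_trans (lerD (ler_normD _ _) (lexx _))) //.
apply: le_trans (lerD (lerD ih b1) b2) _.
move: (en (z.1 - z.2)) (gap zs) (plen (map fst zs)) (plen (map snd zs)) (en z.1) (en z.2) (en p.1)
  g0 w0 l1 l2 v1 v2 p0 {ih h1 c1 c2 b1 b2} => e g L1 L2 a b c g0 e0 L10 L20 a0 b0 c0.
rewrite -subr_ge0 (_ : _ - _ = a * g + a * e + L2 * e + b * e); last by ring.
by rewrite !addr_ge0 // mulr_ge0.
Qed.

(** The parallelogram law gives a gain in w ^ 2, where w = en (z.1 - z.2); the tangent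
    bound w ^ 2 >= 2 a w - a ^ 2 makes it affine in w, so that it sums over the steps. *)
Lemma en_avg_le z (eps a : R) : 0 < eps -> en z.1 <= eps -> en z.2 <= eps ->
  en (avg z) <= eps - (2 * a * en (z.1 - z.2) - a ^+ 2) / (8 * eps).
Proof.
case: z => u v /= e0 ue ve.
have w0 := en_ge0 (u - v); have wle := enB u v.
have par : en (avg (u, v)) ^+ 2 =
    (en u ^+ 2 + en v ^+ 2) / 2 - en (u - v) ^+ 2 / 4.
  by rewrite /avg !en_sqr !dotE (dotC v u) /=; field.
have u2 : en u ^+ 2 <= eps ^+ 2 by rewrite ler_pXn2r // nnegrE ?en_ge0 // ltW.
have v2 : en v ^+ 2 <= eps ^+ 2 by rewrite ler_pXn2r // nnegrE ?en_ge0 // ltW.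
move: (en u) (en v) (en (u - v)) w0 wle par u2 v2 ue ve => x y w.
move=> w0 wle par u2 v2 xe ye.
pose m := eps - w ^+ 2 / (8 * eps).
have w2 : w ^+ 2 <= 4 * eps ^+ 2.
  have -> : 4 * eps ^+ 2 = (2 * eps) ^+ 2 by ring.
  have wle2 : w <= 2 * eps by lra.
  by rewrite ler_pXn2r // nnegrE mulr_ge0 // ltW.
have wd : w ^+ 2 / (8 * eps) <= eps / 2.
  have E : eps / 2 * (8 * eps) = 4 * eps ^+ 2 by field.
  by rewrite ler_pdivrMr ?mulr_gt0 // E.
have m0 : 0 <= m by rewrite /m; lra.
have lem : en (avg (u, v)) <= m.
  rewrite -(@ler_pXn2r _ 2) ?nnegrE ?en_ge0 // par.
  have -> : m ^+ 2 = eps ^+ 2 - w ^+ 2 / 4 + (w ^+ 2 / (8 * eps)) ^+ 2.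
    by rewrite /m; field; rewrite gt_eqF.
  have := sqr_ge0 (w ^+ 2 / (8 * eps)); lra.
apply: (le_trans lem); rewrite /m lerD2l lerN2 ler_pM2r.
  by have := sqr_ge0 (w - a); rewrite sqrrB -mulr_natl; lra.
by rewrite invr_gt0 mulr_gt0.
Qed.

Lemma plen_avg_le (eps a : R) zs : 0 < eps ->
  {in map fst zs, forall v, en v <= eps} ->
  {in map snd zs, forall v, en v <= eps} ->
  plen (map avg zs) <= (size zs)%:R * eps -
    (2 * a * gap zs - (size zs)%:R * a ^+ 2) / (8 * eps).
Proof.
move=> e0; elim: zs => [|z zs ih] h1 h2.
  by rewrite /plen /gap !big_nil /= !mul0r mulr0 subr0 mul0r subr0.
have {}ih : plen (map avg zs) <= (size zs)%:R * eps -
    (2 * a * gap zs - (size zs)%:R * a ^+ 2) / (8 * eps).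
  by apply: ih => v vI; [apply: h1|apply: h2]; rewrite inE vI orbT.
have hz := @en_avg_le z eps a e0 (h1 _ (mem_head _ _)) (h2 _ (mem_head _ _)).
rewrite /plen /gap /= !big_cons -/(plen _) -/(gap _) (le_trans (lerD hz ih)) //.
rewrite -natr1 le_eqVlt; apply/orP; left; apply/eqP; field; rewrite gt_eqF //.
Qed.

(** The gain of all steps, for the best parameter a = gap zs / M; this choice amounts
    to the Cauchy-Schwarz inequality between the gap and the squares of its terms. *)
Lemma plen_avg (rho : R) zs : 0 < rho -> (0 < size zs)%N ->
  {in map fst zs, forall v, en v <= rho / (size zs)%:R} ->
  {in map snd zs, forall v, en v <= rho / (size zs)%:R} ->
  plen (map avg zs) <= rho - gap zs ^+ 2 / (8 * rho).
Proof.
move=> r0 s0 h1 h2; have s0' : 0 < (size zs)%:R :> R by rewrite ltr0n.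
have e0 : 0 < rho / (size zs)%:R by rewrite divr_gt0.
rewrite (le_trans (plen_avg_le (gap zs / (size zs)%:R) e0 h1 h2)) //.
rewrite le_eqVlt; apply/orP; left; apply/eqP; field.
by rewrite !gt_eqF.
Qed.

End Averages.

(** * Uniqueness of the nearest point near a transverse point *)

Section RealArithmetic.
Context {R : realType}.
Implicit Types (x y K : R).

Lemma dist_unit_le1 x y : x \in `[0, 1] -> y \in `[0, 1] -> `|y - x| <= 1.
Proof.
rewrite !in_itv /= => /andP[x0 x1] /andP[y0 y1].
by rewrite ler_norml; apply/andP; split; lra.
Qed.

Lemma norm_perturb {V : normedModType R} (x y u v : V) :
  `|x - y| <= `|(x + u) - (y + v)| + (`|v| + `|u|).
Proof.
have {1}-> : x - y = (x + u - (y + v)) + (v - u).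
  have v0 : (u - v) + (v - u) = 0 by rewrite addrA subrK subrr.
  by rewrite opprD [x + _ + _]addrACA -[RHS]addrA v0 addr0.
by rewrite (le_trans (ler_normD _ _)) // lerD2l ler_normB.
Qed.

Lemma eighth_quarter_le x : 0 <= x -> x / 8 + x / 4 <= x.
Proof. lra. Qed.

Lemma sixteenth_eighth_quarter_le x : 0 <= x -> x / 16 + (x / 8 + x / 4) <= x.
Proof. lra. Qed.

Lemma step_back_le (x B r rho R0 : R) : x <= rho / 2 -> 0 <= B -> rho <= 2 * r ->
  0 < rho -> 16 * (B + 2) * r <= R0 -> x * (1 + B) <= R0 / 16.
Proof.
move=> xr B0 rr r0 h.
have h1 : x * (1 + B) <= r * (1 + B) by rewrite ler_wpM2r ?addr_ge0 //; lra.
have : 0 <= r by lra.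
by move: h1 h; lra.
Qed.


Lemma midpoint_le (m y0 y1 a b K : R) : m - y0 = a * 2^-1 ->
  y1 - m = b * (1 - 2^-1) -> `|b - a| <= K -> `|m| <= (`|y0| + `|y1|) / 2 + K.
Proof.
move=> Ea Eb; rewrite ler_norml => /andP[k1 k2].
have := ler_norm y0; have := ler_norm y1.
have := lerNnormlW (lexx `|y0|); have := lerNnormlW (lexx `|y1|).
by rewrite ler_norml => *; apply/andP; split; lra.
Qed.

(** The gain A ^ 2 / (8 rho) grows as rho shrinks, so that it exceeds the cost Q A ^ 2
    of coming back to S together with the errors proportional to eta. *)
Lemma gain_beats_cost (rho A Q k eta : R) : 0 < rho -> 0 <= A -> A <= 2 * rho ->
  0 <= eta -> 8 * rho * (Q + 1) <= 1 -> eta * (k + 1) < A ^+ 2 ->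
  eta * k + Q * A ^+ 2 + eta < A ^+ 2 / (8 * rho) /\
  eta * k + Q * A ^+ 2 <= rho / 2.
Proof.
move=> r0 A0 Ar e0 Qr ek.
have r8 : 0 < 8 * rho by rewrite mulr_gt0.
have h1 : (Q + 1) * A ^+ 2 <= A ^+ 2 / (8 * rho).
  rewrite ler_pdivlMr // mulrAC ler_piMl ?sqr_ge0 //; lra.
have h2 : A ^+ 2 / (8 * rho) <= rho / 2.
  rewrite ler_pdivrMr // (_ : rho / 2 * (8 * rho) = (2 * rho) ^+ 2); last by field.
  by rewrite ler_pXn2r // nnegrE ltW // mulr_gt0.
by split; move: h1 h2 ek; lra.
Qed.

End RealArithmetic.

Section Chart.
Context {R : realType} {n : nat}.
Implicit Types (p q z v : heis R n) (s : R).

Context (S : set (heis R n)) (f : heis R n -> R) (q0 : heis R n)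
  (w : hplane R n) (R0 L G c : R).
Let W := [set z : heis R n | `|z - q0| < R0].
Context (c0 : 0 < c) (L0 : 0 <= L) (G0 : 0 <= G)
  (dfW : forall z, W z -> differentiable f z)
  (lipW : forall z z' v, W z -> W z' ->
     `|'d f z v - 'd f z' v| <= L * `|z - z'| * `|v|)
  (bndW : forall z v, W z -> `|'d f z v| <= G * `|v|)
  (trW : forall z, W z -> c <= 'd f z (hv z w))
  (SW : forall z, W z -> f z = 0 -> S z)
  (WS : forall z, W z -> S z -> f z = 0).

Let chart_convex z z' s : W z -> W z' -> 0 <= s <= 1 -> W (z + s *: (z' - z)).
Proof. exact: ball_convex. Qed.

Lemma chart_lipschitz z z' : W z -> W z' -> `|f z' - f z| <= G * `|z' - z|.
Proof.
move=> Wz Wz'; pose d := z' - z.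
have Wl s : s \in `[0, 1] -> W (z + s *: d).
  by rewrite in_itv => sI; exact: chart_convex.
have D1 s (sI : s \in `[0, 1]) :
    is_derive s 1 (fun s => f (z + s *: d)) ('d f (z + s *: d) d).
  by apply: is_derive_line; apply: dfW; exact: Wl.
have D2 s (sI : s \in `[(0:R), 1]) :
    is_derive s 1 (fun s => G * `|d| * s) (G * `|d| * 1).
  exact: is_derive_mull.
have B s (sI : s \in `]0, 1[) : `|'d f (z + s *: d) d| <= G * `|d| * 1.
  by rewrite mulr1; apply: bndW; apply: Wl; exact: subset_itv_oo_cc.
have := increment_le ler01 D1 D2 B.
by rewrite scale1r scale0r addr0 mulr1 mulr0 subr0 /d [z + _]addrC subrK.
Qed.

(** The mean value theorem on both halves of the segment reduces the second
    difference of f to the variation of its differential. *)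
Lemma chart_midpoint z z' : W z -> W z' ->
  `|f (z + 2^-1 *: (z' - z))| <=
    (`|f z| + `|f z'|) / 2 + L * `|z' - z| ^+ 2.
Proof.
move=> Wz Wz'; pose d := z' - z.
have Wl s : s \in `[0, 1] -> W (z + s *: d).
  by rewrite in_itv => sI; exact: chart_convex.
have D1 s (sI : s \in `[0, 1]) :
    is_derive s 1 (fun s => f (z + s *: d)) ('d f (z + s *: d) d).
  by apply: is_derive_line; apply: dfW; exact: Wl.
have mvt (a b : R) : 0 <= a -> a < b -> b <= 1 -> exists2 x, x \in `[0, 1] &
    f (z + b *: d) - f (z + a *: d) = 'd f (z + x *: d) d * (b - a).
  move=> a0 ab b1.
  have sub : {subset `[a, b] <= `[0, 1]} by apply: subset_itv; rewrite bnd_simp.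
  have D x : x \in `]a, b[ ->
      is_derive x 1 (fun s => f (z + s *: d)) ('d f (z + x *: d) d).
    by move=> xI; apply: D1; apply: sub; exact: subset_itv_oo_cc.
  have C : {within `[a, b], continuous (fun s => f (z + s *: d))}.
    by apply: derivable_within_continuous => x /sub /D1[].
  have [x xI E] := MVT ab D C.
  by exists x => //; apply: sub; exact: subset_itv_oo_cc.
have h0 : 0 < 2^-1 :> R by [].
have h1 : 2^-1 < 1 :> R by rewrite invf_lt1 // ltr1n.
have [x xI Ex] := mvt 0 2^-1 (lexx _) h0 (ltW h1).
have [y yI Ey] := mvt 2^-1 1 (ltW h0) h1 (lexx _).
rewrite scale0r addr0 subr0 in Ex; rewrite scale1r {1}/d [z + (z' - z)]addrC subrK in Ey.
have dd : `|'d f (z + y *: d) d - 'd f (z + x *: d) d| <= L * `|d| ^+ 2.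
  apply: (le_trans (lipW d (Wl _ yI) (Wl _ xI))).
  rewrite opprD addrACA subrr add0r -scalerBl normrZ expr2 !mulrA.
  rewrite ler_wpM2r // ler_wpM2r // ler_piMr //.
  exact: dist_unit_le1.
exact: midpoint_le Ex Ey dd.
Qed.

(** From a point where f is small, a short horizontal segment leads to S. *)
Lemma chart_zero z (a : R) : 0 <= a -> `|f z| <= c * a ->
  (forall s, `|s| <= a -> W (z + s *: hv z w)) ->
  exists s, `|s| <= a /\ f (z + s *: hv z w) = 0.
Proof.
move=> a0 fz Wl; apply: (zero_on_line a0 fz) => s sa.
by split; [exact/dfW/Wl|have := trW (Wl s sa); rewrite hv_line].
Qed.

Context (n_ge1 : (1 <= n)%N) (B : R) (R0p : 0 < R0)
  (cB : forall z, W z -> en z.1 <= B).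

(** The first summand keeps all the points of the argument within R0 of q0, with B a
    bound on en z.1 there; the second lets the gain in length exceed its cost. *)
Definition uniqueness_radius : R :=
  (16 * (B + 2) / R0 + 16 * ((L * (B + 1) ^+ 2 + G) * en w / c + 1))^-1.

Let r1 := uniqueness_radius.
Let Q := (L * (B + 1) ^+ 2 + G) * en w / c.

Let B_ge0 : 0 <= B.
Proof.
by apply: le_trans (en_ge0 q0.1) (cB _); rewrite /W /= subrr normr0.
Qed.

Let Q_ge0 : 0 <= Q.
Proof.
apply: divr_ge0; last exact: ltW.
apply: mulr_ge0; last exact: en_ge0.
by apply: addr_ge0 => //; rewrite mulr_ge0 // sqr_ge0.
Qed.

Lemma uniqueness_radius_bounds : [/\ 0 < r1, 16 * (B + 2) * r1 <= R0 &
  16 * (Q + 1) * r1 <= 1].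
Proof.
have x0 : 0 < 16 * (B + 2) / R0 by rewrite divr_gt0 // mulr_gt0 // ltr_wpDl.
have y0 : 0 < 16 * (Q + 1) by rewrite mulr_gt0 // ltr_wpDl.
have s0 : 0 < 16 * (B + 2) / R0 + 16 * (Q + 1) by rewrite addr_gt0.
rewrite /r1 /uniqueness_radius -/Q; split.
- by rewrite invr_gt0.
- have E : R0 * (16 * (B + 2) / R0) = 16 * (B + 2) by field; rewrite gt_eqF.
  by rewrite ler_pdivrMr // [R0 * _]mulrDr E lerDl mulr_ge0 // ltW.
- by rewrite ler_pdivrMr // mul1r lerDr ltW.
Qed.

Lemma near_ball_norm p ell rho : `|p - q0| < R0 / 4 -> 0 <= ell -> ell <= rho ->
  rho <= 2 * r1 -> ell * (1 + en p.1 + ell) <= R0 / 8.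
Proof.
move=> pq l0 lr rr; have [r10 hr1 hr2] := uniqueness_radius_bounds.
have Wp : W p by rewrite /W /= (lt_trans pq) // ltr_pdivrMr // ltr_pMr // ltr1n.
have pB := cB Wp; have p0 := en_ge0 p.1.
have ell1 : ell <= 1.
  have : 16 * r1 <= 16 * (Q + 1) * r1 by rewrite ler_pM2r // ler_peMr // lerDr.
  lra.
apply: (@le_trans _ _ (2 * r1 * (B + 2))); last by move: hr1; lra.
apply: ler_pM => //; [by rewrite !addr_ge0|exact: le_trans rr|lra].
Qed.

Lemma chart_inside p z : `|p - q0| < R0 / 4 -> `|z - p| <= R0 / 8 -> W z.
Proof.
move=> pR zp; rewrite /W /= -(subrKA p) (le_lt_trans (ler_normD _ _)) //.
exact: lt_le_trans (ler_ltD zp pR) (eighth_quarter_le (ltW R0p)).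
Qed.

Lemma chart_poly p vs rho : `|p - q0| < R0 / 4 -> rho <= 2 * r1 ->
  plen vs <= rho -> W (foldl step p vs).
Proof.
move=> pR rr lv; apply: (chart_inside pR); apply: (le_trans (foldl_step_norm _ _)).
exact: near_ball_norm (plen_ge0 _) lv rr.
Qed.

(** The average of two polygons that end near S is shorter, by gap ^ 2 / (8 rho), and
    ends where f is of the order of gap ^ 2: its end is close to a midpoint, and f
    is C11. Hence S is reached again within a distance of the order of gap ^ 2,
    which is a smaller amount than the gain. *)
Lemma shorter_competitor p zs rho eta : `|p - q0| < R0 / 4 ->
  0 < rho -> rho <= 2 * r1 -> 0 <= eta ->
  plen (map fst zs) <= rho -> plen (map snd zs) <= rho ->
  plen (map avg zs) <= rho - gap zs ^+ 2 / (8 * rho) ->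
  `|f (foldl step p (map fst zs))| <= G * eta ->
  `|f (foldl step p (map snd zs))| <= G * eta ->
  eta * (G * en w / c + 1) < gap zs ^+ 2 ->
  exists z, S z /\ (cc_dist p z < (rho - eta)%:E)%E.
Proof.
move=> pR rho0 rho2 eta0 L1 L2 La fP1 fP2 etak.
have [r10 hr1 hr2] := uniqueness_radius_bounds.
have r16 : 16 * r1 <= 16 * (Q + 1) * r1 by rewrite ler_pM2r // ler_peMr // lerDr.
have rho8 : 8 * rho <= 1 by lra.
have Wp : W p.
  by apply: (chart_inside pR); rewrite subrr normr0 divr_ge0 // ltW.
have g0 := gap_ge0 zs; have gle := gap_le zs.
have e1 := gap_endpoint1 p zs; have e2 := gap_endpoint2 p zs.
have a1 := avg_endpoint1 p zs; have a2 := avg_endpoint2 p zs.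
have La' : plen (map avg zs) <= rho.
  by apply: (le_trans La); rewrite gerBl divr_ge0 ?sqr_ge0 // mulr_ge0 // ltW.
have WP1 := chart_poly pR rho2 L1; have WP2 := chart_poly pR rho2 L2.
have Wm := chart_poly pR rho2 La'.
have dm : `|foldl step p (map avg zs) - p| <= R0 / 8.
  apply: (le_trans (foldl_step_norm _ _)).
  exact: near_ball_norm (plen_ge0 _) La' rho2.
have mB := cB Wm; have pB := cB Wp.
move: WP1 WP2 Wm e1 e2 a1 a2 fP1 fP2 dm mB.
move EP1 : (foldl step p (map fst zs)) => P1.
move EP2 : (foldl step p (map snd zs)) => P2.
move EPm : (foldl step p (map avg zs)) => Pm.
move Eg : (gap zs) => g in g0 gle La etak *.
move=> WP1 WP2 Wm e1 e2 a1 a2 fP1 fP2 dm mB.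
have B1 : 0 < B + 1 by rewrite ltr_wpDl.
have dP : `|P2 - P1| <= (B + 1) * g.
  rewrite distrC; apply: heis_norm_le => /=.
    by apply: (le_trans e1); rewrite ler_peMl // lerDr.
  apply: (le_trans e2); rewrite ler_wpM2r //.
  by lra.
(* The end Pm of the average is within g ^ 2 of the midpoint, where f is of the
   order of g ^ 2 and eta; coming back to S then costs a * en w. *)
pose mid := P1 + 2^-1 *: (P2 - P1).
have Wmid : W mid.
  by apply: chart_convex => //; rewrite invr_ge0 ler0n invf_le1 // ler1n.
have fmid : `|f mid| <= G * eta + L * ((B + 1) * g) ^+ 2.
  apply: (le_trans (chart_midpoint WP1 WP2)); apply: lerD.
    by lra.
  have Bg : 0 <= (B + 1) * g by rewrite mulr_ge0 // ltW.
  by rewrite ler_wpM2l // ler_pXn2r ?nnegrE.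
have dmid : `|Pm - mid| <= g ^+ 2.
  apply: heis_norm_le => /=.
    rewrite a1 scalerBr scalerDr.
    have -> : P1.1 + (2^-1 *: P2.1 - 2^-1 *: P1.1) =
        2^-1 *: P1.1 + 2^-1 *: P2.1.
      rewrite addrCA addrC; congr (_ + _); apply/eqP; rewrite subr_eq.
      by rewrite -scalerDl -mulr2n -(mulr_natl 2^-1) mulfV ?scale1r ?pnatr_eq0.
    by rewrite subrr en0 sqr_ge0.
  apply: le_trans a2; rewrite le_eqVlt; apply/orP; left; apply/eqP.
  by congr `|_ - _|; rewrite /GRing.scale /=; field.
have fPm : `|f Pm| <= G * eta + (L * (B + 1) ^+ 2 + G) * g ^+ 2.
  have := chart_lipschitz Wmid Wm; have := ler_normD (f mid) (f Pm - f mid).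
  rewrite addrC subrK => h1 h2.
  have h3 : G * `|Pm - mid| <= G * g ^+ 2 by rewrite ler_wpM2l.
  have h4 := le_trans h2 h3; rewrite exprMn in fmid.
  by lra.
pose a := (G * eta + (L * (B + 1) ^+ 2 + G) * g ^+ 2) / c.
have LB : 0 <= L * (B + 1) ^+ 2 + G by rewrite addr_ge0 // mulr_ge0 // sqr_ge0.
have a0 : 0 <= a.
  apply: divr_ge0; last exact: ltW.
  by rewrite addr_ge0 // mulr_ge0 // sqr_ge0.
have aE : a * en w = eta * (G * en w / c) + Q * g ^+ 2.
  by rewrite /a /Q; field; rewrite gt_eqF.
have fPa : `|f Pm| <= c * a by rewrite /a mulrC divfK // gt_eqF.
have g2 : g <= 2 * rho by lra.
have rQ : 8 * rho * (Q + 1) <= 1.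
  have : rho * (Q + 1) <= 2 * r1 * (Q + 1) by rewrite ler_wpM2r // addr_ge0.
  by lra.
have [cost small] := gain_beats_cost rho0 g0 g2 eta0 rQ etak.
rewrite -aE in cost small.
have Wl s : `|s| <= a -> W (Pm + s *: hv Pm w).
  move=> sa.
  have hs : `|s *: hv Pm w| <= R0 / 16.
    apply: le_trans (step_back_le small B_ge0 rho2 rho0 hr1).
    rewrite normrZ -mulrA ler_pM // (le_trans (hv_norm_le _ _)) //.
    by rewrite ler_wpM2l ?en_ge0 // lerD2l.
  rewrite /W /=; have -> : Pm + s *: hv Pm w - q0 =
      s *: hv Pm w + ((Pm - p) + (p - q0)).
    by rewrite subrKA addrAC addrC.
  rewrite (le_lt_trans (ler_normD _ _)) //.
  rewrite (le_lt_trans (lerD (lexx _) (ler_normD _ _))) //.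
  exact: lt_le_trans (ler_ltD hs (ler_ltD dm pR))
    (sixteenth_eighth_quarter_le (ltW R0p)).
have [s [sa fs]] := chart_zero a0 fPa Wl.
exists (Pm + s *: hv Pm w); split; first by apply: SW => //; exact: Wl.
have -> : Pm + s *: hv Pm w = foldl step p (rcons (map avg zs) (s *: w)).
  by rewrite foldl_rcons EPm /step /hv omZr.
rewrite (le_lt_trans (cc_dist_poly _ _)) // lte_fin plen_rcons enZ.
have sw : `|s| * en w <= a * en w by rewrite ler_wpM2r ?en_ge0.
rewrite (le_lt_trans (lerD La sw)) // -ltrBrDl opprB addrA ltrBrDr.
lra.
Qed.

(** Discretized curves to two nearest points have a gap bounded below in terms of
    `|q1 - q2|, whatever the discretization error eta. For small eta the competitor
    is then nearer to p than q1. *)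
Lemma unique_near p q1 q2 : `|p - q0| < R0 / 4 -> nearest S p q1 ->
  nearest S p q2 -> (cc_dist p q1 < r1%:E)%E -> q1 = q2.
Proof.
move=> pR [S1 m1] [S2 m2] dr1; apply/eqP; apply: contraT => neq.
have [r10 hr1 hr2] := uniqueness_radius_bounds.
have N0 : 0 < `|q1 - q2| by rewrite normr_gt0 subr_eq0.
have d12 : cc_dist p q2 = cc_dist p q1.
  by apply/eqP; rewrite eq_le m2 // m1.
pose delta := fine (cc_dist p q1).
have dE : cc_dist p q1 = delta%:E by rewrite fineK // cc_dist_fin.
have dr : delta < r1 by rewrite -lte_fin -dE.
have d0 : 0 <= delta by rewrite -lee_fin -dE cc_dist_ge0.
have B1 : 0 < B + 1 by rewrite ltr_wpDl.
pose k := G * en w / c.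
have k0 : 0 <= k.
  by apply: divr_ge0; [apply: mulr_ge0 => //; exact: en_ge0|exact: ltW].
pose A0 := `|q1 - q2| / (2 * (B + 1)).
have A0p : 0 < A0 by rewrite divr_gt0 // mulr_gt0.
have k1 : 0 < k + 1 by rewrite ltr_wpDl.
(* The first bound on eta keeps the gap above A0; the last one lets the gain, of the
   order of A0 ^ 2, absorb the discretization error. *)
pose eta := Num.min (`|q1 - q2| / 4) (Num.min r1 (A0 ^+ 2 / (2 * (k + 1)))).
have eta0 : 0 < eta.
  by rewrite !lt_min r10 !divr_gt0 // ?exprn_gt0 // mulr_gt0.
have etaN : eta <= `|q1 - q2| / 4 by rewrite ge_min lexx.
have eta1 : eta <= r1 by rewrite !ge_min lexx orbT.
have etak : eta * (k + 1) < A0 ^+ 2.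
  have : eta <= A0 ^+ 2 / (2 * (k + 1)) by rewrite !ge_min lexx !orbT.
  rewrite ler_pdivlMr ?mulr_gt0 // => h.
  have h' : 0 < A0 ^+ 2 by rewrite exprn_gt0.
  by move: h h'; lra.
pose rho := delta + eta.
have rho0 : 0 < rho by rewrite ltr_wpDl.
have rho2 : rho <= 2 * r1 by rewrite mulr_natl mulr2n lerD // ltW.
have lt1 : (cc_dist p q1 < rho%:E)%E by rewrite dE lte_fin ltrDl.
have lt2 : (cc_dist p q2 < rho%:E)%E by rewrite d12.
have [M1 H1] := cc_dist_discretize lt1 eta0.
have [M2 H2] := cc_dist_discretize lt2 eta0.
pose M := (maxn M1 M2).+1.
have MM1 : (M1 <= M)%N by rewrite /M ltnW // ltnS leq_maxl.
have MM2 : (M2 <= M)%N by rewrite /M ltnW // ltnS leq_maxr.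
have [vs1 [t1 [sz1 le1 E1 T1]]] := H1 M MM1.
have [vs2 [t2 [sz2 le2 E2 T2]]] := H2 M MM2.
have M0 : M%:R != 0 :> R by rewrite pnatr_eq0.
have L1 : plen vs1 <= rho by have := plen_le le1; rewrite sz1 mulrC divfK.
have L2 : plen vs2 <= rho by have := plen_le le2; rewrite sz2 mulrC divfK.
pose zs := zip vs1 vs2.
have zs1 : map fst zs = vs1 by rewrite -/(unzip1 zs) unzip1_zip // sz1 sz2.
have zs2 : map snd zs = vs2 by rewrite -/(unzip2 zs) unzip2_zip // sz1 sz2.
have szz : size zs = M by rewrite size_zip sz1 sz2 minnn.
have La : plen (map avg zs) <= rho - gap zs ^+ 2 / (8 * rho).
  by apply: plen_avg; rewrite ?szz ?zs1 ?zs2.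
have Wq q : (cc_dist p q < rho%:E)%E -> W q.
  move=> lt; apply: (chart_inside pR); apply: (le_trans (cc_dist_norm n_ge1 lt)).
  exact: near_ball_norm (ltW rho0) (lexx _) rho2.
have vertn t : `|t| <= eta -> `|vert t : heis R n| <= eta.
  by move=> te; apply: heis_norm_le; rewrite /= ?en0 // ltW.
have fvert q t vs : S q -> (cc_dist p q < rho%:E)%E -> plen vs <= rho ->
    foldl step p vs = q + vert t -> `|t| <= eta -> `|f (foldl step p vs)| <= G * eta.
  move=> Sq lt lvs Ev tle; have WP := chart_poly pR rho2 lvs.
  have := chart_lipschitz (Wq _ lt) WP; rewrite (WS (Wq _ lt) Sq) subr0 {2}Ev.
  rewrite [q + _]addrC addrK.
  by move/le_trans; apply; rewrite ler_wpM2l // vertn.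
have Wp : W p.
  by apply: (chart_inside pR); rewrite subrr normr0 divr_ge0 // ltW.
have gA : A0 <= gap zs.
  have e1 := gap_endpoint1 p zs; have e2 := gap_endpoint2 p zs.
  rewrite zs1 zs2 E1 E2 in e1 e2.
  have dP : `|q1 + vert t1 - (q2 + vert t2)| <= (B + 1) * gap zs.
    apply: heis_norm_le => /=.
      by apply: (le_trans e1); rewrite ler_peMl ?gap_ge0 // lerDr.
    apply: (le_trans e2); rewrite ler_wpM2r ?gap_ge0 // -addrA lerD ?cB //.
    have : 16 * r1 <= 16 * (Q + 1) * r1.
      by rewrite ler_pM2r // ler_peMr // lerDr.
    by move: L1 L2 rho2 hr2; lra.
  have : `|q1 - q2| <= (B + 1) * gap zs + (eta + eta).
    apply: (le_trans (norm_perturb q1 q2 (vert t1) (vert t2))).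
    by apply: (lerD dP); apply: lerD; exact: vertn.
  rewrite /A0 ler_pdivrMr ?mulr_gt0 //.
  by move: etaN; lra.
have gpos : eta * (k + 1) < gap zs ^+ 2.
  apply: (lt_le_trans etak); rewrite ler_pXn2r // nnegrE ?gap_ge0 //.
  exact: ltW.
have l1 : plen (map fst zs) <= rho by rewrite zs1.
have l2 : plen (map snd zs) <= rho by rewrite zs2.
have f1 : `|f (foldl step p (map fst zs))| <= G * eta.
  by rewrite zs1; exact: fvert S1 lt1 L1 E1 T1.
have f2 : `|f (foldl step p (map snd zs))| <= G * eta.
  by rewrite zs2; exact: fvert S2 lt2 L2 E2 T2.
have [z [Sz]] := shorter_competitor pR rho0 rho2 (ltW eta0) l1 l2 La f1 f2 gpos.
have -> : rho - eta = delta by rewrite /rho addrK.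
by rewrite -dE ltNge m1.
Qed.

End Chart.

(** * Nonsingular points and the reach of a compact set *)

Lemma half_lower_bound {R : realType} (x D : R) : `|x - D| <= D / 2 -> D / 2 <= x.
Proof. by rewrite ler_norml => /andP[+ _]; lra. Qed.

Section NonsingularPoints.
Context {R : realType} {n : nat}.
Implicit Types (S U : set (heis R n)) (p q z v : heis R n) (w : hplane R n).

Lemma hvE q v : v = hv q v.1 + theta q v *: vert 1.
Proof.
rewrite [LHS]surjective_pairing; congr pair => /=.
  by rewrite scaler0 addr0.
by rewrite theta_om [_ *: _]mulr1 addrC subrK.
Qed.

Lemma hvN q w : hv q (- w) = - hv q w.
Proof. by rewrite /hv omNr. Qed.

Lemma C11_lipschitz U (f : heis R n -> R) : C11_on U f ->
  exists2 L, 0 <= L & forall z z' v, U z -> U z' ->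
    `|'d f z v - 'd f z' v| <= L * `|z - z'| * `|v|.
Proof.
move=> [_ [L lip]]; exists (Num.max L 0); first by rewrite le_max lexx orbT.
move=> z z' v Uz Uz'; apply: (le_trans (lip _ _ v Uz Uz')).
by rewrite ler_wpM2r // ler_wpM2r // le_max lexx.
Qed.

Lemma open_ball_norm U q : open U -> U q -> exists2 d, 0 < d &
  forall z, `|z - q| < d -> U z.
Proof.
move=> oU Uq; have /nbhs_normP[d /= d0 dU] := open_nbhs_nbhs (conj oU Uq).
by exists d => // z zq; apply: dU; rewrite /= distrC.
Qed.

Lemma tangent_space_ker S U (f : heis R n -> R) q v : open U -> U q ->
  differentiable f q -> S `&` U = [set p | f p = 0] `&` U ->
  tangent_space S q v -> 'd f q v = 0.
Proof.
move=> oU Uq df SU [g [g0 gv gnear]].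
have [_ dg _] := nbhs_singleton gnear.
have cg : {for 0, continuous g} by exact: derivable1_continuous.
have Ug : \forall s \near (0 : R), U (g s).
  by apply: cg; apply: open_nbhs_nbhs; rewrite g0.
have fg : {near (0 : R), f \o g =1 cst 0}.
  apply: filterS2 Ug gnear => s Us [Ss _ _].
  by have : (S `&` U) (g s) by []; rewrite SU => -[].
have dfg : differentiable f (g 0) by rewrite g0.
have dg' : differentiable g 0 by exact/derivable1_diffP.
have e1 : derive1 (f \o g) 0 = 'd f q v.
  rewrite derive1E'; last exact: differentiable_comp.
  by rewrite diff_comp //= -derive1E' // gv g0.
rewrite -e1 derive1E (near_eq_derive _ fg).
by rewrite -derive1E derive1_cst.
Qed.

(** The curve comes from the implicit function theorem, solved along e. *)
Lemma ker_tangent_space S U (f : heis R n -> R) q v e : S q -> open U -> U q ->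
  C11_on U f -> S `&` U = [set p | f p = 0] `&` U ->
  0 < 'd f q e -> 'd f q v = 0 -> tangent_space S q v.
Proof.
move=> Sq oU Uq C11 SU De dv.
have [L L0 lip] := C11_lipschitz C11; have [dfU _] := C11.
have [d d0 dU] := open_ball_norm oU Uq.
pose D := 'd f q e.
have K1 : 0 < L * `|e| + 1 by rewrite ltr_wpDl // mulr_ge0.
pose d' := Num.min d (D / 2 / (L * `|e| + 1)).
have d'0 : 0 < d' by rewrite lt_min d0 !divr_gt0.
have sub z : `|z - q| < d' -> U z.
  by move=> zq; apply: dU; rewrite (lt_le_trans zq) // ge_min lexx.
have fq : f q = 0 by have : (S `&` U) q by []; rewrite SU => -[].
have D2 : 0 < D / 2 by rewrite divr_gt0.
have tr z : `|z - q| < d' -> D / 2 <= 'd f z e.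
  move=> zq.
  have h : L * `|z - q| * `|e| <= D / 2.
    rewrite mulrAC; apply: (@le_trans _ _ ((L * `|e| + 1) * `|z - q|)).
      by rewrite ler_wpM2r // lerDl.
    by rewrite mulrC -ler_pdivlMr // ltW // (lt_le_trans zq) // ge_min lexx orbT.
  exact: half_lower_bound (le_trans (lip z q e (sub z zq) Uq) h).
have [g [g0 gv gnear]] := implicit_curve d'0 L0 D2
  (fun z zq => dfU z (sub z zq))
  (fun z z' u zq zq' => lip z z' u (sub z zq) (sub z' zq')) tr fq dv.
exists g; split=> //; apply: filterS gnear => s [[Ws fs] dg cg]; split=> //.
have : ([set p | f p = 0] `&` U) (g s) by split=> //; exact: sub.
by rewrite -SU => -[].
Qed.

(** Otherwise the differential vanishes on the horizontal vectors; as it is not zero,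
    its kernel consists exactly of these. This kernel is the tangent space, hence q
    is singular. *)
Lemma nonsingular_transverse S U (f : heis R n -> R) q : S q -> open U -> U q ->
  C11_on U f -> (exists v, 'd f q v != 0) ->
  S `&` U = [set p | f p = 0] `&` U -> ~ singular_set S q ->
  exists w, 0 < 'd f q (hv q w).
Proof.
move=> Sq oU Uq C11 [v0 dv0] SU nsing.
have [dfU _] := C11.
apply: contrapT => /forallNP noW; apply: nsing; split=> //.
have dhv w : 'd f q (hv q w) = 0.
  apply/eqP; rewrite eq_le !leNgt; apply/andP; split; apply/negP.
    exact: noW.
  by move=> h; apply: (noW (- w)); rewrite hvN linearN /= oppr_gt0.
have dT : 'd f q (vert 1) != 0.
  apply: contra dv0 => /eqP T0.
  by rewrite (hvE q v0) linearD linearZ /= dhv T0 scaler0 addr0.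
have [e De] : exists e, 0 < 'd f q e.
  have [|h] := ltP 0 ('d f q (vert 1)); first by exists (vert 1).
  by exists (- vert 1); rewrite linearN /= oppr_gt0 lt_neqAle dT h.
apply/seteqP; split=> v.
  move=> /(tangent_space_ker oU Uq (dfU q Uq) SU) dv.
  apply/horizontalP; apply/eqP; rewrite -subr_eq0 -theta_om.
  move: dv; rewrite {1}(hvE q v) linearD linearZ /= dhv add0r => /eqP.
  by rewrite mulf_eq0 (negPf dT) orbF.
move=> /horizontalE hv_v.
by apply: (ker_tangent_space Sq oU Uq C11 SU De); rewrite hv_v.
Qed.

(** The chart at q0 and its constants serve for all neighbouring points, which gives
    a uniform radius. *)
Lemma local_reach S q0 : (1 <= n)%N -> closed S -> C11_hypersurface S ->
  S q0 -> ~ singular_set S q0 ->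
  exists r1 r2, [/\ 0 < r1, 0 < r2 & forall q, S q -> `|q - q0| < r1 ->
     cc_ball q r2 `<=` Unp S].
Proof.
move=> n1 cS hS Sq0 nsing.
have [U [f [oU Uq0 C11 reg SU]]] := hS q0 Sq0.
have [w Dw] := nonsingular_transverse Sq0 oU Uq0 C11 (reg q0 Uq0) SU nsing.
have [L L0 lip] := C11_lipschitz C11; have [dfU _] := C11.
have [d d0 dU] := open_ball_norm oU Uq0.
have [G1 G10 bnd] : exists2 G1, 0 <= G1 & forall u, `|'d f q0 u| <= G1 * `|u|.
  have /linear_boundedP[M [_ /(_ (Num.max 0 M + 1)) H]] :
      bounded_near ('d f q0) (nbhs 0).
    apply/linear_bounded_continuous; exact: (diff_continuous (dfU q0 Uq0)).
  exists (Num.max 0 M + 1); first by rewrite addr_ge0 // le_max lexx.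
  by apply: H; rewrite (@le_lt_trans _ _ (Num.max 0 M)) ?le_max ?lexx ?orbT // ltrDl.
pose D := 'd f q0 (hv q0 w); pose m : R := n.*2%:R.
have m0 : 0 <= m by [].
pose B := m * (`|q0| + 1).
have B0 : 0 <= B by rewrite mulr_ge0 // addr_ge0.
have w0 := en_ge0 w.
pose K := L * (en w * (1 + B)) + G1 * (m * en w).
have K0 : 0 <= K by rewrite addr_ge0 ?mulr_ge0 // addr_ge0.
have K1 : 0 < K + 1 by rewrite ltr_wpDl.
(* The last bound keeps the derivative of f along the field with components w
   above D / 2, half its value at q0. *)
pose R0 := Num.min d (Num.min 1 (D / 2 / (K + 1))).
have R0p : 0 < R0 by rewrite !lt_min d0 ltr01 !divr_gt0.
have WU z : `|z - q0| < R0 -> U z.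
  by move=> zq; apply: dU; rewrite (lt_le_trans zq) // ge_min lexx.
have cB z : `|z - q0| < R0 -> en z.1 <= B.
  move=> zq; rewrite (le_trans (en1_le _)) // ler_wpM2l // -[z](subrK q0) addrC.
  rewrite (le_trans (ler_normD _ _)) // lerD2l ltW // (lt_le_trans zq) //.
  by rewrite !ge_min lexx orbT.
have D2 : 0 < D / 2 by rewrite divr_gt0.
have Wq0 : `|q0 - q0| < R0 by rewrite subrr normr0.
have tr z : `|z - q0| < R0 -> D / 2 <= 'd f z (hv z w).
  move=> zq.
  have h1 : `|'d f z (hv z w) - 'd f q0 (hv z w)| <=
      L * (en w * (1 + B)) * `|z - q0|.
    apply: (le_trans (lip _ _ _ (WU z zq) Uq0)).
    rewrite mulrAC ler_wpM2r // ler_wpM2l // (le_trans (hv_norm_le _ _)) //.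
    by rewrite ler_wpM2l // lerD2l cB.
  have h2 : `|'d f q0 (hv z w) - 'd f q0 (hv q0 w)| <=
      G1 * (m * en w) * `|z - q0|.
    rewrite -linearB (le_trans (bnd _)) // -mulrA ler_wpM2l //.
    apply: heis_norm_le => /=.
      by rewrite subrr en0 !mulr_ge0.
    rewrite -omNl -omDl (le_trans (om_le _ _)) // mulrAC ler_wpM2r //.
    exact: (en1_le (z - q0)).
  have h3 : K * `|z - q0| <= D / 2.
    apply: (@le_trans _ _ ((K + 1) * `|z - q0|)).
      by rewrite ler_wpM2r // lerDl.
    rewrite mulrC -ler_pdivlMr // ltW // (lt_le_trans zq) //.
    by rewrite !ge_min lexx !orbT.
  apply: half_lower_bound; rewrite -(subrKA ('d f q0 (hv z w))) (le_trans (ler_normD _ _)) //.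
  by rewrite (le_trans (lerD h1 h2)) // -mulrDl.
pose G := G1 + L * R0.
have G0 : 0 <= G by rewrite addr_ge0 // mulr_ge0 // ltW.
have bndW z v : `|z - q0| < R0 -> `|'d f z v| <= G * `|v|.
  move=> zq; rewrite -['d f z v](subrK ('d f q0 v)) (le_trans (ler_normD _ _)) //.
  rewrite mulrDl addrC lerD // (le_trans (lip _ _ _ (WU z zq) Uq0)) //.
  by rewrite ler_wpM2r // ler_wpM2l // ltW.
have SW z : `|z - q0| < R0 -> f z = 0 -> S z.
  move=> zq fz; have : ([set p | f p = 0] `&` U) z by split=> //; exact: WU.
  by rewrite -SU => -[].
have WS z : `|z - q0| < R0 -> S z -> f z = 0.
  move=> zq Sz; have : (S `&` U) z by split=> //; exact: WU.
  by rewrite SU => -[].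
pose r2 := uniqueness_radius w R0 L G (D / 2) B.
have [r20 _ _] := uniqueness_radius_bounds w D2 L0 G0 R0p cB.
exists (R0 / 8), r2; split=> //; first by rewrite divr_gt0.
move=> q Sq qq0 p pq.
have qq4 : `|q - q0| < R0 / 4.
  apply: (lt_le_trans qq0); apply: ler_wpM2l; first exact: ltW.
  by rewrite lef_pV2 ?posrE // ler_nat.
have pq4 : `|p - q0| < R0 / 4.
  have pq8 : `|p - q| <= R0 / 8.
    apply: (le_trans (cc_dist_norm n1 pq)).
    have r22 : r2 <= 2 * r2 by rewrite mulr_natl mulr2n lerDl ltW.
    exact: (near_ball_norm D2 L0 G0 R0p cB qq4 (ltW r20) (lexx _) r22).
  rewrite -(subrKA q) (le_lt_trans (ler_normD _ _)) //.
  apply: lt_le_trans (ler_ltD pq8 qq0) _.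
  by rewrite le_eqVlt; apply/orP; left; apply/eqP; field.
have dpq : (cc_dist p q < r2%:E)%E by exact: cc_dist_sym_lt.
have [q1 nq1] := nearest_exists n1 p cS Sq.
have dpq1 : (cc_dist p q1 < r2%:E)%E by apply: le_lt_trans dpq; exact: nq1.2.
exists q1; split=> // q2 nq2.
exact: (unique_near D2 L0 G0 (fun z zq => dfU z (WU z zq))
  (fun z z' v zq zq' => lip z z' v (WU z zq) (WU z' zq'))
  bndW tr SW WS n1 R0p cB pq4 nq1 nq2 dpq1).
Qed.

End NonsingularPoints.

Theorem theorem4p5 (R : realType) (n : nat) (n_ge1 : (1 <= n)%N)
    (S : set (heis R n)) (S_closed : closed S) (S_C11 : C11_hypersurface S)
    (K : set (heis R n)) (K_compact : compact K)
    (K_sub : K `<=` S `\` singular_set S) :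
  (0 < reach_set S K)%E.
Proof.
have loc x : K x -> \forall x' \near x & r \near 0^'+,
    S x' -> cc_ball x' r `<=` Unp S.
  move=> /K_sub[Sx nx].
  have [r1 [r2 [r10 r20 H]]] := local_reach n_ge1 S_closed S_C11 Sx nx.
  near=> x' r.
  have xx : `|x' - x| < r1.
    by rewrite distrC; near: x'; apply: cvgr_dist_lt.
  have rr : r <= r2 by near: r; exact: nbhs_right_le.
  move=> Sx' p pr; apply: (H x' Sx' xx).
  by apply: (lt_le_trans pr); rewrite lee_fin.
have /compact_near_coveringP/(_ _ _ _ _ loc) near_r := K_compact.
have [r [r0 Hr]] : exists r : R, 0 < r /\ forall x, K x -> S x -> cc_ball x r `<=` Unp S.
  have /filter_ex[r [rr0 rH]] : \forall r \near (0 : R)^'+, 0 < r /\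
      K `<=` (fun x => S x -> cc_ball x r `<=` Unp S).
    by near=> r; split=> //; near: r; exact: near_r.
  by exists r; split=> // x /rH.
apply: (@lt_le_trans _ _ r%:E); first by rewrite lte_fin.
apply/ereal_infP => _ [q Kq <-].
apply: ereal_sup_ubound; right; exists r => //; split=> //.
by apply: Hr => //; exact: (K_sub _ Kq).1.
Unshelve. all: by end_near. Qed.
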